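(* (Forest reordering.) The $\mathbb G$-expansion, whose first forests are $$\begin{aligned} \mathbb G^2&=(\tfrac12a^2+b)\,Y\diamond Y,\\ \mathbb G^3&=a(\tfrac12a^2+b)\,(Y\diamond Y)\diamond Y,\\ \mathbb G^4&=\tfrac12(\tfrac12a^2+b)^2\,(Y\diamond Y)\diamond(Y\diamond Y)+a^2(\tfrac12a^2+b)\,((Y\diamond Y)\diamond Y)\diamond Y,\\ \mathbb G^5&=a(\tfrac12a^2+b)^2\,((Y\diamond Y)\diamond Y)\diamond(Y\diamond Y)+\tfrac12a(\tfrac12a^2+b)^2\,((Y\diamond Y)\diamond(Y\diamond Y))\diamond Y\\ &\quad+a^3(\tfrac12a^2+b)\,(((Y\diamond Y)\diamond Y)\diamond Y)\diamond Y, \end{aligned}$$ is a reordering, based on the number of leaves, of the $2$-variate $\mathbb K$-expansion applied to $A_T=(Y_T,\langle Y\rangle_T)$, whose first terms are $$\begin{aligned} \mathbb K^1&=a\,Y+b\,Y\diamond Y,\\ \mathbb K^2&=\tfrac12a^2\,Y\diamond Y+ab\,(Y\diamond Y)\diamond Y+\tfrac12b^2\,(Y\diamond Y)\diamond(Y\diamond Y),\\ \mathbb K^3&=\tfrac12a^3\,(Y\diamond Y)\diamond Y+\tfrac12a^2b\,(Y\diamond Y)\diamond(Y\diamond Y)+a^2b\,((Y\diamond Y)\diamond Y)\diamond Y\\ &\quad+ab^2\,((Y\diamond Y)\diamond Y)\diamond(Y\diamond Y)+\tfrac12ab^2\,((Y\diamond Y)\diamond(Y\diamond Y))\diamond Y+\cdots,\\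 \mathbb K^4&=\tfrac12a^4\,((Y\diamond Y)\diamond Y)\diamond Y+\tfrac18a^4\,(Y\diamond Y)\diamond(Y\diamond Y)+\tfrac12a^3b\,((Y\diamond Y)\diamond Y)\diamond(Y\diamond Y)\\ &\quad+\tfrac12a^3b\,((Y\diamond Y)\diamond(Y\diamond Y))\diamond Y+a^3b\,(((Y\diamond Y)\diamond Y)\diamond Y)\diamond Y+\tfrac12a^3b\,((Y\diamond Y)\diamond Y)\diamond(Y\diamond Y)+\cdots,\\ \mathbb K^5&=\tfrac12a^5\,(((Y\diamond Y)\diamond Y)\diamond Y)\diamond Y+\tfrac18a^5\,((Y\diamond Y)\diamond(Y\diamond Y))\diamond Y+\tfrac14a^5\,((Y\diamond Y)\diamond Y)\diamond(Y\diamond Y)+\cdots. \end{aligned}$$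
   Context: Work on a filtered probability space on which all martingales admit a continuous version, with $T$ fixed and $\mathbb E_t=\mathbb E[\cdot\mid\mathcal F_t]$. $Y$ is the martingale $Y_t=\mathbb E_t[Y_T]$ generated by a real-valued $\mathcal F_T$-measurable, sufficiently integrable random variable $Y_T$, with quadratic variation $\langle Y\rangle$. Diamond product: for continuous semimartingales $P,Q$ with integrable covariation, $(P\diamond Q)_t(T)=\mathbb E_t[\langle P,Q\rangle_T]-\langle P,Q\rangle_t$; it is commutative but not associative. Iterated diamond products of $Y$ are pictured as binary trees: $Y$ is a single leaf, and $\tau_1\diamond\tau_2$ is the tree obtained by joining the roots of $\tau_1$ and $\tau_2$; the number of leaves is the number of factors $Y$. Linear combinations of trees are called forests. The $\mathbb G$-expansion is $\log\mathbb E_t[e^{aY_T+b\langle Y\rangle_T}]=aY_t+b\langle Y\rangle_t+\sum_{k\ge2}\mathbb G^k_t$, with $\mathbb G^2=(\tfrac12a^2+b)\,Y\diamond Y$ and $\mathbb G^k=\tfrac12\sum_{j=2}^{k-2}\mathbb G^{k-j}\diamond\mathbb G^j+a\,Y\diamond\mathbb G^{k-1}$ for $k>2$. The $2$-variate $\mathbb K$- (cumulant) expansion of the pair $(Y_T,\langle Y\rangle_T)$ expands the same quantity by homogeneity in $(a,b)$, through the recursion $\mathbb K^{n+1}=\tfrac12\sum_{k=1}^n\mathbb K^k\diamond\mathbb K^{n+1-k}$, started from the conditional expectation of $aY_T+b\langle Y\rangle_T$. Here $\mathbb E_t\langle Y\rangle_T=(Y\diamond Y)_t(T)+\langle Y\rangle_t$;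 the bounded variation term $b\langle Y\rangle_t$ is omitted from the displayed $\mathbb K^1$, since it does not contribute to subsequent diamond products (it appears as the separate term $b\langle Y\rangle_t$ in the $\mathbb G$-expansion). *)

(* Defs.v *)
From HB Require Import structures.
From mathcomp Require Import all_boot all_order all_algebra.
From mathcomp Require Import all_classical all_reals all_analysis.
From mathcomp Require Import finmap.
(* The notations of monalg clash with those of MathComp-Analysis. *)
From mathcomp.multinomials Require Import -(notations) monalg.

Set Implicit Arguments.
Unset Strict Implicit.
Unset Printing Implicit Defensive.

Import Order.TTheory GRing.Theory Num.Theory.
Import numFieldNormedType.Exports.
Local Open Scope classical_set_scope.
Local Open Scope ring_scope.

(** * Course-of-values recursion, and the two expansions

   Both expansions are written for an arbitrary product [op] on an arbitrary
   [R]-module, and are used twice: for forests with the formal product of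
   trees, and for processes with the stochastic diamond product. *)

Section Recursion.
Context {V : nmodType}.
Variable step : nat -> (nat -> V) -> V.

(* [rec_upto n i] is the [i]-th term for [i <= n]. *)
Fixpoint rec_upto (n : nat) : nat -> V :=
  if n is m.+1 then
    fun i => if i == n then step n (rec_upto m) else rec_upto m i
  else fun i => if i == 0%N then step 0 (fun=> 0) else 0.

Definition cv_rec (n : nat) : V := rec_upto n n.

Lemma rec_uptoE n i : (i <= n)%N -> rec_upto n i = cv_rec i.
Proof.
elim: n => [|n IHn]; first by rewrite leqn0 => /eqP ->.
rewrite leq_eqVlt => /predU1P[-> //|i_lt] /=.
by rewrite (ltn_eqF i_lt) IHn.
Qed.

Lemma cv_recE n :
    (forall m u v, (forall i, (i < m)%N -> u i = v i) ->
      step m u = step m v) ->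
  cv_rec n = step n cv_rec.
Proof.
move=> step_local; rewrite {1}/cv_rec; case: n => [|n] /=; rewrite ?eqxx.
  exact: step_local.
by apply: step_local => i i_lt; exact: rec_uptoE.
Qed.

End Recursion.

Section Expansions.
Context {R : realType} {V : lmodType R}.
Variable op : V -> V -> V.

(* [Gexp a b y k] is G^k, for k >= 2; it is 0 for k < 2. *)
Definition Gexp (a b : R) (y : V) : nat -> V :=
  cv_rec (fun k (G : nat -> V) =>
    if (k < 2)%N then 0
    else if k == 2%N then (2^-1 * a ^+ 2 + b) *: op y y
    else 2^-1 *: (\sum_(2 <= j < k.-1) op (G (k - j)%N) (G j))
         + a *: op y (G k.-1)).

(* [Kexp k1 n] is K^n, for n >= 1, when K^1 = k1; it is 0 for n = 0. *)
Definition Kexp (k1 : V) : nat -> V :=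
  cv_rec (fun n (K : nat -> V) =>
    if n == 1%N then k1
    else 2^-1 *: (\sum_(1 <= k < n) op (K k) (K (n - k)%N))).

Lemma Gexp2 a b y : Gexp a b y 2 = (2^-1 * a ^+ 2 + b) *: op y y.
Proof. by []. Qed.

Lemma Gexp_rec a b y k : (2 < k)%N ->
  Gexp a b y k =
    2^-1 *: (\sum_(2 <= j < k.-1) op (Gexp a b y (k - j)%N) (Gexp a b y j))
    + a *: op y (Gexp a b y k.-1).
Proof.
move=> k_gt2; rewrite {1}/Gexp cv_recE => [|[|m] u v uv].
- by rewrite ltnNge (ltnW k_gt2) (gtn_eqF k_gt2).
- by [].
case: ifP => // k_ge2; case: ifP => // _; congr (_ *: _ + _ *: op y _).
  apply: eq_big_nat => j /andP[j_ge2 j_lt] /=.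
  rewrite !uv ?(leq_trans j_lt) ?leqnSn //.
  by rewrite ltn_subrL /= (leq_trans _ j_ge2).
by apply: uv.
Qed.

Lemma Kexp1 k1 : Kexp k1 1 = k1.
Proof. by []. Qed.

Lemma Kexp_rec k1 n : (0 < n)%N ->
  Kexp k1 n.+1 =
    2^-1 *: (\sum_(1 <= k < n.+1) op (Kexp k1 k) (Kexp k1 (n.+1 - k)%N)).
Proof.
move=> n_gt0; rewrite {1}/Kexp cv_recE => [|m u v uv].
  by rewrite eqSS (gtn_eqF n_gt0).
case: ifP => // _; congr (_ *: _); apply: eq_big_nat => k /andP[k_gt0 k_lt].
by rewrite !uv ?ltn_subrL ?k_gt0 ?(leq_ltn_trans _ k_lt).
Qed.

End Expansions.

(** * Trees and forests *)

(* Planar binary trees; the trees of the text are their classes modulo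
   exchanging the two subtrees of any node, since the diamond product is
   commutative but not associative. *)
Inductive ptree := PLeaf | PNode of ptree & ptree.

Fixpoint ptree_code (s : ptree) : GenTree.tree unit :=
  if s is PNode s1 s2 then GenTree.Node 0 [:: ptree_code s1; ptree_code s2]
  else GenTree.Leaf tt.

Fixpoint ptree_decode (c : GenTree.tree unit) : option ptree :=
  match c with
  | GenTree.Leaf _ => Some PLeaf
  | GenTree.Node _ [:: c1; c2] =>
      match ptree_decode c1, ptree_decode c2 with
      | Some s1, Some s2 => Some (PNode s1 s2)
      | _, _ => None
      end
  | _ => None
  end.

Lemma ptree_codeK : pcancel ptree_code ptree_decode.
Proof. by elim=> //= s1 -> s2 ->. Qed.

HB.instance Definition _ := Choice.copy ptree (pcan_type ptree_codeK).

Fixpoint ptree_eqv (s t : ptree) : bool :=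
  match s, t with
  | PLeaf, PLeaf => true
  | PNode s1 s2, PNode t1 t2 =>
      (ptree_eqv s1 t1 && ptree_eqv s2 t2) ||
      (ptree_eqv s1 t2 && ptree_eqv s2 t1)
  | _, _ => false
  end.

Lemma ptree_eqv_refl : reflexive ptree_eqv.
Proof. by elim=> //= s1 -> s2 ->. Qed.

Lemma ptree_eqv_sym : symmetric ptree_eqv.
Proof.
elim=> [|s1 IH1 s2 IH2] [|t1 t2] //=.
by rewrite !IH1 !IH2 [ptree_eqv t2 s1 && _]andbC.
Qed.

Lemma ptree_eqv_trans : transitive ptree_eqv.
Proof.
move=> t s u; elim: s t u => [|s1 IH1 s2 IH2] [|t1 t2] [|u1 u2] //=.
case/orP=> /andP[st1 st2] /orP[]/andP[tu1 tu2]; apply/orP.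
- by left; rewrite (IH1 _ _ st1 tu1) (IH2 _ _ st2 tu2).
- by right; rewrite (IH1 _ _ st1 tu1) (IH2 _ _ st2 tu2).
- by right; rewrite (IH1 _ _ st1 tu2) (IH2 _ _ st2 tu1).
- by left; rewrite (IH1 _ _ st1 tu2) (IH2 _ _ st2 tu1).
Qed.

Canonical ptree_equiv :=
  EquivRel ptree_eqv ptree_eqv_refl ptree_eqv_sym ptree_eqv_trans.

Definition tree := {eq_quot ptree_equiv}%qT.
HB.instance Definition _ := Choice.on tree.
HB.instance Definition _ := EqQuotient.on tree.

Definition leaf : tree := (\pi_tree PLeaf)%qT.
Definition join (s t : tree) : tree := (\pi_tree (PNode (repr s) (repr t)))%qT.

Fixpoint pleaves (s : ptree) : nat :=
  if s is PNode s1 s2 then (pleaves s1 + pleaves s2)%N else 1%N.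
Definition leaves (s : tree) : nat := pleaves (repr s).

Fixpoint peval (V : Type) (op : V -> V -> V) (y : V) (s : ptree) : V :=
  if s is PNode s1 s2 then op (peval op y s1) (peval op y s2) else y.

(* Meaningful when [op] is commutative, see [tree_eval_join]. *)
Definition tree_eval (V : Type) (op : V -> V -> V) (y : V) (s : tree) : V :=
  peval op y (repr s).

Lemma peval_eqv (V : Type) (op : V -> V -> V) (y : V) (s t : ptree) :
  commutative op -> ptree_eqv s t -> peval op y s = peval op y t.
Proof.
move=> opC; elim: s t => [|s1 IH1 s2 IH2] [|t1 t2] //=.
by case/orP=> /andP[/IH1-> /IH2->] //; rewrite opC.
Qed.

Lemma pleaves_eqv (s t : ptree) : ptree_eqv s t -> pleaves s = pleaves t.
Proof.
elim: s t => [|s1 IH1 s2 IH2] [|t1 t2] //=.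
by case/orP=> /andP[/IH1-> /IH2->] //; rewrite addnC.
Qed.

Lemma repr_pi_eqv (s : ptree) : ptree_eqv (repr (\pi_tree s)%qT) s.
Proof. by have /eqmodP := reprK (\pi_tree s)%qT. Qed.

Lemma joinC : commutative join.
Proof.
by move=> s t; apply/eqmodP => /=; rewrite !ptree_eqv_refl orbT.
Qed.

Lemma leaves_leaf : leaves leaf = 1%N.
Proof. exact: (pleaves_eqv (repr_pi_eqv PLeaf)). Qed.

Lemma leaves_join s t : leaves (join s t) = (leaves s + leaves t)%N.
Proof. exact: (pleaves_eqv (repr_pi_eqv (PNode (repr s) (repr t)))). Qed.

Lemma tree_eval_leaf (V : Type) (op : V -> V -> V) (y : V) :
  commutative op -> tree_eval op y leaf = y.
Proof. by move=> opC; exact: (peval_eqv y opC (repr_pi_eqv PLeaf)). Qed.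

Lemma tree_eval_join (V : Type) (op : V -> V -> V) (y : V) s t :
  commutative op ->
  tree_eval op y (join s t) = op (tree_eval op y s) (tree_eval op y t).
Proof.
move=> opC.
exact: (peval_eqv y opC (repr_pi_eqv (PNode (repr s) (repr t)))).
Qed.

(* Finitely supported formal linear combinations of trees. *)
Notation forest R := (malg tree R).

Section Forests.
Context {R : realType}.

Local Notation forest := (malg tree R).

Definition forest_leaf : forest := mkmalgU leaf 1.

Definition forest_diamond (f g : forest) : forest :=
  \sum_(s <- msupp f) \sum_(t <- msupp g)
    mkmalgU (join s t) (mcoeff s f * mcoeff t g).

(* The part of [f] carried by the trees whose number of leaves is in [D]. *)
Definition leaf_part (D : pred nat) (f : forest) : forest :=
  \sum_(s <- msupp f | D (leaves s)) mkmalgU s (mcoeff s f).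

Definition forest_eval (V : lmodType R) (op : V -> V -> V) (y : V)
    (f : forest) : V :=
  \sum_(s <- msupp f) mcoeff s f *: tree_eval op y s.

Definition forestG (a b : R) : nat -> forest :=
  Gexp forest_diamond a b forest_leaf.

(* K^1 is displayed without its bounded variation part b <Y>; this part is
   kept in [processK] below. *)
Definition forestK (a b : R) : nat -> forest :=
  Kexp forest_diamond
    (a *: forest_leaf + b *: forest_diamond forest_leaf forest_leaf).

End Forests.

Notation "f ◇ g" := (forest_diamond f g)
  (at level 39, left associativity) : ring_scope.

(** * The stochastic diamond product on [0, T] *)

Section Diamond.
Context {R : realType} {d : measure_display} {Omega : measurableType d}.
Variables (P : probability Omega R) (T : R) (F : R -> set (set Omega)).

(* Processes are indexed by all reals, but only the times in [0, T] matter. *)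
Local Notation process := (R -> Omega -> R).

Definition filtration : Prop :=
  (forall t, 0 <= t <= T ->
     sigma_algebra setT (F t) /\ F t `<=` measurable) /\
  (forall s t, 0 <= s -> s <= t -> t <= T -> F s `<=` F t).

Definition measurable_wrt (G : set (set Omega)) (X : Omega -> R) : Prop :=
  forall B, measurable B -> G (X @^-1` B).

Definition integrable_rv (X : Omega -> R) : Prop :=
  P.-integrable setT (EFin \o X).

Definition is_condexp (G : set (set Omega)) (X Z : Omega -> R) : Prop :=
  [/\ integrable_rv X, integrable_rv Z, measurable_wrt G Z &
      forall A, G A ->
        (\int[P]_(w in A) (Z w)%:E = \int[P]_(w in A) (X w)%:E)%E].

Definition adapted (X : process) : Prop :=
  forall t, 0 <= t <= T -> measurable_wrt (F t) (X t).

Definition continuous_paths (X : process) : Prop :=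
  {ae P, forall w, {within `[0, T], continuous (fun t => X t w)}}.

Definition bounded_variation_paths (X : process) : Prop :=
  {ae P, forall w, bounded_variation 0 T (fun t => X t w)}.

Definition version (X X' : process) : Prop :=
  forall t, 0 <= t <= T -> {ae P, forall w, X t w = X' t w}.

(* The case s = t says that M is adapted and integrable. *)
Definition martingale (M : process) : Prop :=
  forall s t, 0 <= s -> s <= t -> t <= T -> is_condexp (F s) (M t) (M s).

Definition martingales_have_continuous_versions : Prop :=
  forall M, martingale M ->
    exists M', [/\ martingale M', continuous_paths M' & version M M'].

(* M is a continuous version of t |-> E_t[X]. *)
Definition is_condexp_process (X : Omega -> R) (M : process) : Prop :=
  continuous_paths M /\
  forall t, 0 <= t <= T -> is_condexp (F t) X (M t).

Definition condexp_process (X : Omega -> R) : process :=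
  xget (0 : process) [set M | is_condexp_process X M].

(* A partition 0 < s_1 < ... < s_n = t is given by the list of the s_i. *)
Definition mesh (s : seq R) : R :=
  \big[Num.max/0]_(i < size s) ((0 :: s)`_i.+1 - (0 :: s)`_i).

Definition cov_sum (X Z : process) (s : seq R) (w : Omega) : R :=
  \sum_(i < size s) (X (0 :: s)`_i.+1 w - X (0 :: s)`_i w) *
                    (Z (0 :: s)`_i.+1 w - Z (0 :: s)`_i w).

Definition cvg_in_probability (U : nat -> Omega -> R) (V : Omega -> R) :=
  forall e : R, 0 < e ->
    P [set w | e <= `|U n w - V w|] @[n --> \oo] --> 0%E.

(* C is the bracket <X, Z> of the continuous adapted processes X and Z: the
   limit in probability of the sums of products of increments along
   partitions whose mesh tends to 0. It always exists when X and Z are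
   semimartingales (and the filtration is complete). *)
Definition is_covariation (X Z C : process) : Prop :=
  [/\ adapted X /\ continuous_paths X,
      adapted Z /\ continuous_paths Z,
      adapted C /\ continuous_paths C,
      bounded_variation_paths C &
      forall t, 0 <= t <= T -> forall p : nat -> seq R,
        (forall n, itv_partition 0 t (p n)) ->
        mesh (p n) @[n --> \oo] --> (0 : R) ->
        cvg_in_probability (fun n => cov_sum X Z (p n)) (C t)].

Definition covariation (X Z : process) : process :=
  xget (0 : process) [set C | is_covariation X Z C].

Definition diamond (X Z : process) : process :=
  fun t w => condexp_process (covariation X Z T) t w - covariation X Z t w.

Lemma diamondC : commutative diamond.
Proof.
suff covC X Z : covariation X Z = covariation Z X.
  by move=> X Z; rewrite /diamond covC.
rewrite /covariation; congr xget; apply/seteqP.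
suff sub X' Z' : [set C | is_covariation X' Z' C] `<=`
                 [set C | is_covariation Z' X' C] by split; exact: sub.
move=> C [hX hZ hC bvC lim]; split => // t tT p pt mp e e0.
have -> : cov_sum Z' X' = cov_sum X' Z'; last exact: (lim t tT p pt mp e e0).
apply/funext => s; apply/funext => w.
by apply: eq_bigr => i _; rewrite mulrC.
Qed.

Variable YT : Omega -> R.

Definition Y_process : process := condexp_process YT.

(* The process pictured by a tree, resp. by a linear combination of trees. *)
Definition tree_process : tree -> process := tree_eval diamond Y_process.
Definition forest_process : forest R -> process :=
  forest_eval diamond Y_process.

Lemma tree_process_leaf : tree_process leaf = Y_process.
Proof. exact: (tree_eval_leaf _ diamondC). Qed.

Lemma tree_process_join s t :
  tree_process (join s t) = diamond (tree_process s) (tree_process t).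
Proof. exact: (tree_eval_join _ _ _ diamondC). Qed.

(* All the iterated diamond products of Y are defined. *)
Definition sufficiently_integrable : Prop :=
  integrable_rv YT /\
  forall s t : tree, exists C : process,
    is_covariation (tree_process s) (tree_process t) C /\
    integrable_rv (C T).

Definition quadratic_variation : process := covariation Y_process Y_process.

Definition processG (a b : R) : nat -> process := Gexp diamond a b Y_process.

(* K^1_t = E_t[a Y_T + b <Y>_T]. *)
Definition processK (a b : R) : nat -> process :=
  Kexp diamond
    (condexp_process (fun w => a * YT w + b * quadratic_variation T w)).

End Diamond.

(* Main.v *)
(** The diamond product of forests adds numbers of leaves. Hence the [k]-leaf
   parts of all the K^n add up to forests S_k that satisfy the convolution
   recursion 2 S_k = \sum_i S_i ◇ S_{k-i} for k > 2, with S_1 = a Y and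
   S_2 = (a^2/2 + b) Y ◇ Y; isolating the terms i = 1 and i = k - 1 gives the
   recursion of G.

   A forest pictures the process built by the same recursion because the
   stochastic diamond product is bilinear up to versions: the bracket, as a
   limit in probability of sums of products of increments, is bilinear,
   unique up to versions and unchanged by passing to versions, and so is the
   conditional expectation, which exists by the Radon-Nikodym theorem on the
   sub-sigma-algebra. The term b <Y> of K^1 has bounded variation, so its
   bracket with any continuous process vanishes. *)
Require Import Defs.
From HB Require Import structures.
From mathcomp Require Import all_boot all_order all_algebra.
From mathcomp Require Import all_classical all_reals all_analysis.
From mathcomp Require Import measurable_realfun random_variable.
From mathcomp Require Import finmap ring lra zify.
From mathcomp.multinomials Require Import -(notations) monalg.

Set Implicit Arguments.
Unset Strict Implicit.
Unset Printing Implicit Defensive.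

Import Order.TTheory GRing.Theory Num.Theory.
Import numFieldNormedType.Exports.
Local Open Scope classical_set_scope.
Local Open Scope ring_scope.

(** * The algebra of forests *)

(** [covariation] and [condexp_process] are arbitrary choices among the processes that satisfy a
    specification, so bilinearity of the stochastic product can only be expected up to versions.
    Moreover, [sufficiently_integrable] supplies brackets for pairs of trees only. For linear
    combinations a bracket has to be exhibited, as the bilinear expression in the brackets of trees,
    before the chosen one can be compared with it. The induction along the two recursions also
    carries adaptedness and continuity of paths, which a version does not inherit.

    On the side of forests there are two gradings, by the index n and by the number of leaves. The
    recursion of K is a convolution for the one, the product of forests for the other. Including the
    terms K^0 = 0 and S_0 = 0 lets both convolutions run over full ranges, and the sums involved are
    finite because K^n has no tree with fewer than n leaves. *)

Section LinearExtension.
Context {R : realType} {V : lmodType R}.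
Implicit Types (phi : tree -> V) (f g : forest R).

(** Forests are free on trees: the diamond product, [leaf_part] and [forest_eval] are all extensions
    of this form, so linearity is proved once and identities are checked on single trees. *)
Definition linext phi f : V := \sum_(s <- msupp f) mcoeff s f *: phi s.

(** Cancellation can shrink the support of a sum; additivity is therefore proved on a common larger
    set of trees. *)
Lemma linextEw phi f (D : {fset tree}) : (msupp f `<=` D)%fset ->
  linext phi f = \sum_(s <- D) mcoeff s f *: phi s.
Proof.
move=> fD; apply: big_fset_incl => // s _ sf.
by rewrite mcoeff_outdom // scale0r.
Qed.

Lemma linext_is_linear phi : linear (linext phi).
Proof.
move=> c f g.
have fD : (msupp f `<=` msupp f `|` msupp g)%fset by exact: fsubsetUl.
have gD : (msupp g `<=` msupp f `|` msupp g)%fset by exact: fsubsetUr.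
have fgD : (msupp (c *: f + g) `<=` msupp f `|` msupp g)%fset.
  by rewrite (fsubset_trans (msuppD_le _ _))// fsetSU// msuppZ_le.
rewrite (linextEw phi fD) (linextEw phi gD) (linextEw phi fgD).
rewrite scaler_sumr -big_split /=; apply: eq_bigr => s _.
by rewrite mcoeffD mcoeffZ scalerDl scalerA.
Qed.

HB.instance Definition _ phi :=
  GRing.isLinear.Build R (malg tree R) V *:%R (linext phi)
    (linext_is_linear phi).

Lemma linextU phi s c : linext phi (mkmalgU s c) = c *: phi s.
Proof.
rewrite (linextEw phi (msuppU_le (k := s) (x := c))).
by rewrite big_seq_fset1 mcoeffUU.
Qed.

Lemma eq_linext phi phi' f : (forall s, s \in msupp f -> phi s = phi' s) ->
  linext phi f = linext phi' f.
Proof. by move=> e; rewrite /linext !big_seq; apply: eq_bigr => s /e ->. Qed.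

End LinearExtension.

Lemma linext_linext (R : realType) (V : lmodType R) (psi : tree -> V)
    (phi : tree -> forest R) f :
  linext psi (linext phi f) = linext (fun s => linext psi (phi s)) f.
Proof.
rewrite [linext phi f]/linext linear_sum; apply: eq_bigr => s _.
exact: linearZ.
Qed.

Section ForestAlgebra.
Context {R : realType}.
Implicit Types (f g h : forest R) (s t : tree) (D : pred nat).

Local Notation U s := (mkmalgU s (1 : R)).

Lemma linext_id f : linext (fun s => U s) f = f.
Proof.
rewrite [RHS]monalgE /linext; apply: eq_bigr => s _; apply/malgP => t.
by rewrite mcoeffZ !mcoeffU mulr_natr.
Qed.

Lemma mkmalgUZ s (c : R) : mkmalgU s c = c *: U s.
Proof. by apply/malgP => t; rewrite mcoeffZ !mcoeffU mulr_natr. Qed.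

Lemma diamond_linext f g :
  forest_diamond f g = linext (fun s => linext (fun t => U (join s t)) g) f.
Proof.
rewrite /forest_diamond /linext; apply: eq_bigr => s _.
rewrite scaler_sumr; apply: eq_bigr => t _.
by rewrite scalerA -mkmalgUZ.
Qed.

Lemma leaf_part_linext D f :
  leaf_part D f = linext (fun s => if D (leaves s) then U s else 0) f.
Proof.
rewrite /leaf_part big_mkcond; apply: eq_bigr => s _.
by case: ifP => _; rewrite ?scaler0 // -mkmalgUZ.
Qed.

Lemma forest_diamond_is_linear f : linear (forest_diamond f).
Proof.
move=> c g h; rewrite !diamond_linext /linext scaler_sumr -big_split /=.
apply: eq_bigr => s _; rewrite -!/(linext _ _) linearP scalerDr !scalerA.
by rewrite mulrC.
Qed.

HB.instance Definition _ f :=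
  GRing.isLinear.Build R (malg tree R) (malg tree R) *:%R (forest_diamond f)
    (forest_diamond_is_linear f).

Lemma forest_diamondUU s t : U s ◇ U t = U (join s t).
Proof. by rewrite diamond_linext !linextU !scale1r. Qed.

Lemma forest_diamondC : commutative (@forest_diamond R).
Proof.
move=> f g; rewrite /forest_diamond exchange_big /=.
apply: eq_bigr => s _; apply: eq_bigr => t _.
by rewrite Defs.joinC mulrC.
Qed.

Lemma forest_diamondDl f g h : (f + g) ◇ h = f ◇ h + g ◇ h.
Proof. by rewrite forest_diamondC linearD /= !(forest_diamondC h). Qed.

Lemma forest_diamondZl c f g : (c *: f) ◇ g = c *: (f ◇ g).
Proof. by rewrite forest_diamondC linearZ /= forest_diamondC. Qed.

Lemma forest_diamondDr f g h : f ◇ (g + h) = f ◇ g + f ◇ h.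
Proof. exact: linearD. Qed.

Lemma forest_diamondZr c f g : f ◇ (c *: g) = c *: (f ◇ g).
Proof. exact: linearZ. Qed.

Lemma forest_diamond0r f : f ◇ 0 = 0.
Proof. exact: linear0. Qed.

Definition forest_diamondE := (forest_diamondDl, forest_diamondDr,
  forest_diamondZl, forest_diamondZr).

Lemma forest_diamond0l f : 0 ◇ f = 0.
Proof. by rewrite forest_diamondC linear0. Qed.

Lemma forest_diamond_suml I (r : seq I) (Q : pred I) (F : I -> forest R) g :
  (\sum_(i <- r | Q i) F i) ◇ g = \sum_(i <- r | Q i) (F i ◇ g).
Proof.
rewrite forest_diamondC linear_sum; apply: eq_bigr => i _.
exact: forest_diamondC.
Qed.

Lemma forest_diamond_sumr I (r : seq I) (Q : pred I) (F : I -> forest R) f :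
  f ◇ (\sum_(i <- r | Q i) F i) = \sum_(i <- r | Q i) (f ◇ F i).
Proof. exact: linear_sum. Qed.

Lemma mem_msupp_diamond f g s : s \in msupp (f ◇ g) ->
  exists s1 s2, [/\ s1 \in msupp f, s2 \in msupp g & s = join s1 s2].
Proof.
rewrite -mcoeff_neq0; apply: contraNP => no.
rewrite /forest_diamond raddf_sum /= big_seq big1 // => s1 s1f.
rewrite raddf_sum /= big_seq big1 // => s2 s2g.
rewrite mcoeffU; case: eqP => // sE.
by case: no; exists s1, s2.
Qed.

Lemma mem_msuppD f g s : s \in msupp (f + g) ->
  s \in msupp f \/ s \in msupp g.
Proof. by move/(fsubsetP (msuppD_le _ _)); rewrite in_fsetU => /orP. Qed.

Lemma mem_msuppZ c f s : s \in msupp (c *: f) -> s \in msupp f.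
Proof. exact/fsubsetP/msuppZ_le. Qed.

Lemma mem_msupp_sum (r : seq nat) (F : nat -> forest R) s :
  s \in msupp (\sum_(i <- r) F i) -> exists2 i, i \in r & s \in msupp (F i).
Proof.
rewrite -mcoeff_neq0; apply: contraNP => no.
rewrite raddf_sum /= big_seq big1 // => i ir; apply/eqP.
by rewrite mcoeff_eq0; apply/negP => si; apply: no; exists i.
Qed.

Lemma mem_msuppU s t (c : R) : s \in msupp (mkmalgU t c) -> s = t.
Proof. by move/(fsubsetP msuppU_le); rewrite in_fset1 => /eqP. Qed.

Lemma leaf_part_is_linear D : linear (@leaf_part R D).
Proof. by move=> c f g; rewrite !leaf_part_linext linearP. Qed.

HB.instance Definition _ D :=
  GRing.isLinear.Build R (malg tree R) (malg tree R) *:%R (leaf_part D)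
    (leaf_part_is_linear D).

Lemma leaf_partD D f g : leaf_part D (f + g) = leaf_part D f + leaf_part D g.
Proof. exact: linearD. Qed.

Lemma leaf_partZ D c f : leaf_part D (c *: f) = c *: leaf_part D f.
Proof. exact: linearZ. Qed.

Lemma leaf_part0 D : leaf_part D (0 : forest R) = 0.
Proof. exact: linear0. Qed.

Lemma leaf_part_sum D I (r : seq I) (Q : pred I) (F : I -> forest R) :
  leaf_part D (\sum_(i <- r | Q i) F i) =
  \sum_(i <- r | Q i) leaf_part D (F i).
Proof. exact: linear_sum. Qed.

Lemma leaf_partU D s : leaf_part D (U s) = if D (leaves s) then U s else 0.
Proof. by rewrite leaf_part_linext linextU scale1r. Qed.

Lemma leaf_part_eq0 D f : (forall s, s \in msupp f -> ~~ D (leaves s)) ->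
  leaf_part D f = 0.
Proof.
move=> fD; rewrite leaf_part_linext /linext big_seq big1 // => s /fD.
by move=> /negbTE ->; rewrite scaler0.
Qed.

(** Trees span the forests, so bilinear maps are determined by their values on pairs of trees. *)
Lemma eq_bilinear_forest (V : lmodType R) (B B' : forest R -> forest R -> V) :
  (forall f, linear (B f)) -> (forall f, linear (B' f)) ->
  (forall g, linear (B^~ g)) -> (forall g, linear (B'^~ g)) ->
  (forall s t, B (U s) (U t) = B' (U s) (U t)) ->
  forall f g, B f g = B' f g.
Proof.
move=> Br B'r Bl B'l BB' f g.
have ext (L : forest R -> V) : linear L ->
    forall f, L f = linext (fun s => L (U s)) f.
  (* The linearity hypothesis is packed into a structure so that the generic lemmas on linear maps
     apply to [L]. *)
  move=> linL k; pose mL := GRing.isLinear.Build R _ V *:%R L linL.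
  pose LL : {linear forest R -> V} := HB.pack L mL.
  rewrite -{1}(linext_id k) /linext -[L]/(LL : _ -> _) linear_sum.
  by apply: eq_bigr => s _; rewrite linearZ.
rewrite (ext (B^~ g))// (ext (B'^~ g))//; apply: eq_linext => s _.
rewrite (ext (B _))// (ext (B' _))//; apply: eq_linext => t _.
exact: BB'.
Qed.

(** Numbers of leaves add, so a tree beyond the cutoff never yields one below it. Truncating the
    factors first keeps the computation of K^4 and K^5 short. *)
Lemma leaf_part_le_diamond k f g :
  leaf_part (fun m => m <= k)%N (f ◇ g) =
  leaf_part (fun m => m <= k)%N
    (leaf_part (fun m => m <= k)%N f ◇ leaf_part (fun m => m <= k)%N g).
Proof.
move: f g; apply: eq_bilinear_forest => [f c g h|f c g h|g c f h|g c f h|s t] /=.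
- by rewrite !linearP.
- by rewrite !linearP.
- by rewrite forest_diamondDl forest_diamondZl linearP.
- by rewrite linearP forest_diamondDl forest_diamondZl linearP.
rewrite !leaf_partU; case: leqP => sk; last first.
  rewrite forest_diamond0l linear0 forest_diamondUU leaf_partU ifF //.
  by rewrite leaves_join; apply/negbTE; lia.
case: leqP => // tk.
rewrite forest_diamond0r leaf_part0 forest_diamondUU leaf_partU ifF //.
by rewrite leaves_join; apply/negbTE; lia.
Qed.

(** On two trees, the only index that can contribute is the number of leaves of the left one. *)
Lemma leaf_part_diamond k f g :
  leaf_part (pred1 k) (f ◇ g) =
  \sum_(0 <= i < k.+1)
     leaf_part (pred1 i) f ◇ leaf_part (pred1 (k - i)%N) g.
Proof.
move: f g; apply: eq_bilinear_forest => [f c g h|f c g h|g c f h|g c f h|s t] /=.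
- by rewrite !linearP.
- rewrite scaler_sumr -big_split; apply: eq_bigr => i _ /=.
  by rewrite !linearP.
- by rewrite forest_diamondDl forest_diamondZl linearP.
- rewrite scaler_sumr -big_split; apply: eq_bigr => i _ /=.
  by rewrite linearP forest_diamondDl forest_diamondZl.
rewrite forest_diamondUU leaf_partU leaves_join /=.
case: eqP => [<-|ne].
  rewrite (bigD1_seq (leaves s)) ?iota_uniq ?mem_index_iota //=; last by lia.
  rewrite !leaf_partU /= eqxx addKn eqxx forest_diamondUU big1 ?addr0 // => i ne.
  by rewrite leaf_partU /= eq_sym (negbTE ne) forest_diamond0l.
rewrite big_nat big1 // => i ik; rewrite !leaf_partU /=.
case: eqP => [si|_]; last by rewrite forest_diamond0l.
by rewrite ifF ?linear0 //; apply/negbTE/eqP => ti; lia.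
Qed.

End ForestAlgebra.

(** * The displayed first terms of both expansions *)

Definition linear_forms_separate (R : realType) (V : lmodType R) : Prop :=
  forall f g : V,
    (forall c : V -> R, (forall x y, c (x + y) = c x + c y) ->
       (forall k x, c (k *: x) = k * c x) -> c f = c g) ->
    f = g.

(** The coefficient of a given tree is a linear form, and these coefficients determine a forest. *)
Lemma forest_linear_forms_separate (R : realType) :
  linear_forms_separate (malg tree R).
Proof.
move=> f g fg; apply/malgP => s.
by apply: fg => [x y|k x]; rewrite ?mcoeffD ?mcoeffZ.
Qed.

(* A linear form held as a variable turns an identity between forests into a
   scalar one whose atoms [field] need not compare by conversion. *)
Ltac forest_field :=
  match goal with
  | V : lmodType _, sep : linear_forms_separate _ |- _ =>
      repeat match goal with
      | |- context [?op ?f ?g] => is_var op; generalize (op f g); intro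
      | |- context [?U ?t] => is_var U;
           match type of (U t) with GRing.Lmodule.sort _ => idtac end;
           generalize (U t); intro
      end;
      let c := fresh "c" in let cD := fresh "cD" in let cZ := fresh "cZ" in
      rewrite ?(scaler0, addr0, add0r); apply: sep => c cD cZ;
      rewrite ?(cD, cZ); field
  end.

(* The displayed forests are computed for abstract operations and sequences:
   comparing concrete forests by conversion would unfold them. *)
Section FirstForests.
Context {R : realType}.
Variables (V : lmodType R) (sep : linear_forms_separate V).
Variables (a b : R) (op : V -> V -> V) (Y : V).
Variables (G K : nat -> V).

Local Notation "f '⋄' g" := (op f g) (at level 39, left associativity).
Local Notation g2 := (2^-1 * a ^+ 2 + b).

Hypothesis opC : commutative op.
Hypothesis opDl : forall f g h, (f + g) ⋄ h = f ⋄ h + g ⋄ h.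
Hypothesis opZl : forall c f g, (c *: f) ⋄ g = c *: (f ⋄ g).

Let opDr f g h : f ⋄ (g + h) = f ⋄ g + f ⋄ h.
Proof. by rewrite opC opDl !(opC f). Qed.

Let opZr c f g : f ⋄ (c *: g) = c *: (f ⋄ g).
Proof. by rewrite opC opZl (opC f). Qed.

Let opE := (opDl, opDr, opZl, opZr).

Hypothesis G2 : G 2 = g2 *: (Y ⋄ Y).
Hypothesis G_rec : forall k, (2 < k)%N ->
  G k = 2^-1 *: (\sum_(2 <= j < k.-1) G (k - j)%N ⋄ G j) + a *: (Y ⋄ G k.-1).

Lemma first_G3 : G 3 = (a * g2) *: ((Y ⋄ Y) ⋄ Y).
Proof.
rewrite (G_rec (k := 3) isT) big_geq; last by [].
rewrite scaler0 add0r G2 opZr scalerA.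
rewrite (opC Y); reflexivity.
Qed.

Lemma first_G4 :
  G 4 = (2^-1 * g2 ^+ 2) *: ((Y ⋄ Y) ⋄ (Y ⋄ Y))
        + (a ^+ 2 * g2) *: (((Y ⋄ Y) ⋄ Y) ⋄ Y).
Proof.
rewrite (G_rec (k := 4) isT) big_nat1 first_G3 G2.
rewrite !opE !scalerA (opC Y (_ ⋄ Y)).
by forest_field.
Qed.

Lemma first_G5 :
  G 5 = (a * g2 ^+ 2) *: (((Y ⋄ Y) ⋄ Y) ⋄ (Y ⋄ Y))
        + (2^-1 * a * g2 ^+ 2) *: (((Y ⋄ Y) ⋄ (Y ⋄ Y)) ⋄ Y)
        + (a ^+ 3 * g2) *: ((((Y ⋄ Y) ⋄ Y) ⋄ Y) ⋄ Y).
Proof.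
rewrite (G_rec (k := 5) isT) big_nat_recr; last by [].
rewrite big_nat1 first_G4 first_G3 G2.
rewrite !opE (opC (Y ⋄ Y) (_ ⋄ Y)).
rewrite (opC Y (_ ⋄ (Y ⋄ Y))) (opC Y (_ ⋄ Y)).
by forest_field.
Qed.

Hypothesis K1 : K 1 = a *: Y + b *: (Y ⋄ Y).
Hypothesis K_rec : forall n, (0 < n)%N ->
  K n.+1 = 2^-1 *: (\sum_(1 <= k < n.+1) K k ⋄ K (n.+1 - k)%N).

Lemma first_K2 :
  K 2 = (2^-1 * a ^+ 2) *: (Y ⋄ Y) + (a * b) *: ((Y ⋄ Y) ⋄ Y)
        + (2^-1 * b ^+ 2) *: ((Y ⋄ Y) ⋄ (Y ⋄ Y)).
Proof.
rewrite (K_rec (n := 1) isT) big_nat1 K1 !opE (opC Y (_ ⋄ Y)).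
by forest_field.
Qed.

Variables (U : tree -> V) (part5 : V -> V).
Hypothesis YU : Y = U leaf.
Hypothesis opU : forall s t, U s ⋄ U t = U (join s t).
Hypothesis part5D : forall f g, part5 (f + g) = part5 f + part5 g.
Hypothesis part5Z : forall c f, part5 (c *: f) = c *: part5 f.
Hypothesis part5U :
  forall s, part5 (U s) = if (leaves s <= 5)%N then U s else 0.
Hypothesis part5_op : forall f g, part5 (f ⋄ g) = part5 (part5 f ⋄ part5 g).

Lemma first_K3 :
  part5 (K 3) =
    (2^-1 * a ^+ 3) *: ((Y ⋄ Y) ⋄ Y)
    + (2^-1 * a ^+ 2 * b) *: ((Y ⋄ Y) ⋄ (Y ⋄ Y))
    + (a ^+ 2 * b) *: (((Y ⋄ Y) ⋄ Y) ⋄ Y)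
    + (a * b ^+ 2) *: (((Y ⋄ Y) ⋄ Y) ⋄ (Y ⋄ Y))
    + (2^-1 * a * b ^+ 2) *: (((Y ⋄ Y) ⋄ (Y ⋄ Y)) ⋄ Y).
Proof.
rewrite (K_rec (n := 2) isT) big_nat_recr; last by [].
rewrite big_nat1  (opC (K 1)).
rewrite first_K2 K1 !opE !(part5D, part5Z).
rewrite ?YU !opU !part5U !leaves_join !leaves_leaf /=.
by forest_field.
Qed.

(** Up to commutativity, K^4 is K^3 ◇ K^1 plus half of K^2 ◇ K^2. Each of the two contributes a^3 b
    / 2 to the tree ((Y ◇ Y) ◇ Y) ◇ (Y ◇ Y), which is why this term appears twice; the coefficient
    1/8 is half the square of a^2/2. *)
Lemma first_K4 :
  part5 (K 4) =
    (2^-1 * a ^+ 4) *: (((Y ⋄ Y) ⋄ Y) ⋄ Y)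
    + (8^-1 * a ^+ 4) *: ((Y ⋄ Y) ⋄ (Y ⋄ Y))
    + (2^-1 * a ^+ 3 * b) *: (((Y ⋄ Y) ⋄ Y) ⋄ (Y ⋄ Y))
    + (2^-1 * a ^+ 3 * b) *: (((Y ⋄ Y) ⋄ (Y ⋄ Y)) ⋄ Y)
    + (a ^+ 3 * b) *: ((((Y ⋄ Y) ⋄ Y) ⋄ Y) ⋄ Y)
    + (2^-1 * a ^+ 3 * b) *: (((Y ⋄ Y) ⋄ Y) ⋄ (Y ⋄ Y)).
Proof.
rewrite (K_rec (n := 3) isT) 2?big_nat_recr; try by [].
rewrite big_nat1 (opC (K 1)).
rewrite part5Z !part5D [part5 (K 3 ⋄ _)]part5_op.
rewrite first_K3 first_K2 K1 !(part5D, part5Z).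
rewrite !YU !opU !part5U !leaves_join !leaves_leaf /= !opE.
rewrite !(part5D, part5Z) !opU !part5U !leaves_join !leaves_leaf /=.
(* The cross terms of K^2 ◇ K^2 give the same tree in both orders; products have become [join] by
   now, so commutativity is used on trees. *)
rewrite (Defs.joinC (join leaf leaf) (join (join leaf leaf) leaf)).
by forest_field.
Qed.

(** K^5 has no tree with fewer than five leaves, so the cutoff keeps exactly the terms in a^5; the
    coefficient 1/4 comes from K^3 ◇ K^2, as a^3/2 times a^2/2. *)
Lemma first_K5 :
  part5 (K 5) =
    (2^-1 * a ^+ 5) *: ((((Y ⋄ Y) ⋄ Y) ⋄ Y) ⋄ Y)
    + (8^-1 * a ^+ 5) *: (((Y ⋄ Y) ⋄ (Y ⋄ Y)) ⋄ Y)
    + (4^-1 * a ^+ 5) *: (((Y ⋄ Y) ⋄ Y) ⋄ (Y ⋄ Y)).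
Proof.
rewrite (K_rec (n := 4) isT) 3?big_nat_recr; try by [].
rewrite big_nat1 (opC (K 1)).
rewrite (opC (K 2)) part5Z !part5D.
rewrite [part5 (K 4 ⋄ _)]part5_op.
rewrite [part5 (K 3 ⋄ _)]part5_op.
rewrite first_K4 first_K3 first_K2 K1 !(part5D, part5Z).
rewrite !YU !opU !part5U !leaves_join !leaves_leaf /= !opE.
rewrite !(part5D, part5Z) !opU !part5U !leaves_join !leaves_leaf /=.
by forest_field.
Qed.

End FirstForests.

(** * Reordering by leaves *)

(** The antidiagonals fill the triangle j + m <= k, and the hypothesis kills the rest of the
    square. *)
Lemma sum_antidiagonals (V : nmodType) (k : nat) (F : nat -> nat -> V) :
  (forall j m, (k < j + m)%N -> F j m = 0) ->
  \sum_(0 <= n < k.+1) \sum_(0 <= j < n.+1) F j (n - j)%N =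
  \sum_(0 <= j < k.+1) \sum_(0 <= m < k.+1) F j m.
Proof.
move=> F0.
transitivity (\sum_(0 <= n < k.+1) \sum_(0 <= j < k.+1 | (j < n.+1)%N)
    F j (n - j)%N).
  rewrite big_nat [RHS]big_nat; apply: eq_bigr => n /andP[_ nk].
  by rewrite (big_nat_widen _ _ k.+1).
rewrite (exchange_big_dep_nat xpredT) //= big_nat [RHS]big_nat.
apply: eq_bigr => j /andP[_ jk].
transitivity (\sum_(0 <= m < (k.+1 - j)%N) F j m).
  have E : \sum_(0 + j <= n < k.+1) F j (n - j)%N =
           \sum_(0 <= m < (k.+1 - j)%N) F j m.
    by rewrite big_addn; apply: eq_bigr => m _; rewrite addnK.
  rewrite add0n in E; rewrite -E {E}.
  rewrite (big_cat_nat (n := j)) //=; last by lia.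
  rewrite [X in X + _]big1_seq ?add0r; last first.
    by move=> n; rewrite mem_index_iota; lia.
  by apply: congr_big_nat => // n; lia.
rewrite [RHS](big_cat_nat (n := (k.+1 - j)%N)) //=; last by lia.
rewrite [X in _ + X]big_nat [X in _ + X]big1 ?addr0 // => m jm.
by apply: F0; lia.
Qed.

Section Homogeneity.
Context {R : realType} {V : lmodType R}.
Variables (op : V -> V -> V).
Hypothesis opZl : forall c f g, op (c *: f) g = c *: op f g.
Hypothesis opZr : forall c f g, op f (c *: g) = c *: op f g.

(** A product of terms of degrees k and n - k has degree n. *)
Lemma Kexp_homogeneous (c : R) (k1 : V) (n : nat) : (1 <= n)%N ->
  Kexp op (c *: k1) n = c ^+ n *: Kexp op k1 n.
Proof.
elim/ltn_ind: n => -[|[|n]] // IH _.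
rewrite !Kexp_rec // scalerA mulrC -scalerA [in RHS]scaler_sumr; congr (_ *: _).
apply: eq_big_nat => k /andP[k_gt0 kn].
rewrite !IH ?opZl ?opZr ?scalerA -?exprD; [|lia..].
by rewrite subnKC // ltnW.
Qed.

End Homogeneity.

(** In the convolution for S_k the terms i = 1 and i = k - 1 are equal by commutativity; their sum
    absorbs the factor 1/2. *)
Lemma half_plus_twice (R : realType) (V : lmodType R) (x y : V) :
  2^-1 *: (x + (y + y)) = 2^-1 *: x + y.
Proof.
rewrite scalerDr -mulr2n -scalerMnr scalerMnl -[_^-1 *+ 2]mulr_natr.
by rewrite mulVf ?pnatr_eq0 // scale1r.
Qed.

Section Reordering.
Context {R : realType}.
Variables (a b : R) (G K : nat -> forest R).

Local Notation Y := (forest_leaf : forest R).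
Local Notation leaf_sum k := (\sum_(0 <= n < k.+1) leaf_part (pred1 k) (K n)).

Hypothesis G2 : G 2 = (2^-1 * a ^+ 2 + b) *: (Y ◇ Y).
Hypothesis G_rec : forall k, (2 < k)%N ->
  G k = 2^-1 *: (\sum_(2 <= j < k.-1) G (k - j)%N ◇ G j) + a *: (Y ◇ G k.-1).
Hypothesis K0 : K 0 = 0.
Hypothesis K1 : K 1 = a *: Y + b *: (Y ◇ Y).
Hypothesis K_rec : forall n, (0 < n)%N ->
  K n.+1 = 2^-1 *: (\sum_(1 <= k < n.+1) K k ◇ K (n.+1 - k)%N).

(** Both bounds hold for the two trees of K^1 and are additive under joining. The lower one leaves
    finitely many n for each number of leaves. *)
Lemma leaves_msuppK n s : (1 <= n)%N -> s \in msupp (K n) ->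
  (n <= leaves s <= 2 * n)%N.
Proof.
elim/ltn_ind: n s => -[|[|n]] // IH s _.
  rewrite K1 => /mem_msuppD[] /mem_msuppZ.
    by move/mem_msuppU ->; rewrite leaves_leaf.
  by rewrite forest_diamondUU => /mem_msuppU ->; rewrite leaves_join leaves_leaf.
rewrite K_rec // => /mem_msuppZ /mem_msupp_sum[k].
rewrite mem_index_iota => kn /mem_msupp_diamond[s1 [s2 [s1K s2K ->]]].
rewrite leaves_join.
have := IH k _ s1 _ s1K; have := IH _ _ s2 _ s2K; lia.
Qed.

Lemma leaves_msuppG k s : (2 <= k)%N -> s \in msupp (G k) -> leaves s = k.
Proof.
elim/ltn_ind: k s => -[|[|[|k]]] // IH s _.
  rewrite G2 forest_diamondUU => /mem_msuppZ /mem_msuppU ->.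
  by rewrite leaves_join leaves_leaf.
rewrite G_rec // => /mem_msuppD[] /mem_msuppZ.
  move=> /mem_msupp_sum[j]; rewrite mem_index_iota => jk.
  move=> /mem_msupp_diamond[s1 [s2 [s1G s2G ->]]]; rewrite leaves_join.
  by rewrite (IH _ _ _ _ s1G) ?(IH _ _ _ _ s2G); lia.
move=> /mem_msupp_diamond[s1 [s2 [/mem_msuppU -> s2G ->]]].
by rewrite leaves_join leaves_leaf (IH _ _ _ _ s2G).
Qed.

Lemma leaf_part_K_eq0 k n : (k < n)%N -> leaf_part (pred1 k) (K n) = 0.
Proof.
move=> kn; apply: leaf_part_eq0 => s /leaves_msuppK sK /=.
by apply/negP => /eqP sk; have := sK (leq_trans _ kn); lia.
Qed.

(** Extending the range adds only zero terms; all S_i with i <= k can thus be summed over the same n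
    before sums are exchanged. *)
Lemma leaf_sum_widen k N : (k <= N)%N ->
  \sum_(0 <= n < N.+1) leaf_part (pred1 k) (K n) = leaf_sum k.
Proof.
move=> kN; rewrite (big_cat_nat (n := k.+1)) //=.
rewrite [X in _ + X]big_nat [X in _ + X]big1 ?addr0 // => n /andP[kn _].
exact: leaf_part_K_eq0.
Qed.

(** Since K^0 = 0, the recursion can be stated for every n as a full convolution plus a source term
    concentrated at n = 1. *)
Lemma K_rec_total n :
  K n = (if n == 1%N then a *: Y + b *: (Y ◇ Y) else 0)
        + 2^-1 *: (\sum_(0 <= j < n.+1) K j ◇ K (n - j)%N).
Proof.
case: n => [|[|n]] /=.
- by rewrite big_nat1 K0 forest_diamond0l scaler0 addr0.
- rewrite big_nat_recr //= big_nat1 K0 forest_diamond0l forest_diamond0r.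
  by rewrite addr0 scaler0 addr0 K1.
rewrite add0r K_rec // [in RHS]big_nat_recr //= [in RHS]big_ltn // subnn K0.
by rewrite forest_diamond0l forest_diamond0r add0r addr0.
Qed.

(** Convolving in n and in the number of leaves at once, the sum over n separates and the product of
    S_i and S_{k-i} remains. *)
Lemma leaf_sum_rec k :
  leaf_sum k = leaf_part (pred1 k) (\sum_(0 <= n < k.+1 | n == 1%N)
          (a *: Y + b *: (Y ◇ Y)))
        + 2^-1 *: (\sum_(0 <= i < k.+1) leaf_sum i ◇ leaf_sum (k - i)%N).
Proof.
under eq_bigr do rewrite K_rec_total leaf_partD leaf_partZ.
rewrite big_split /=; congr (_ + _).
  by rewrite leaf_part_sum [RHS]big_mkcond; apply: eq_bigr => n _; case: eqP;
     rewrite ?leaf_part0.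
rewrite -scaler_sumr; congr (_ *: _).
transitivity (\sum_(0 <= i < k.+1) \sum_(0 <= n < k.+1) \sum_(0 <= j < n.+1)
    leaf_part (pred1 i) (K j) ◇ leaf_part (pred1 (k - i)%N) (K (n - j)%N)).
  rewrite [RHS]exchange_big /=; apply: eq_bigr => n _.
  rewrite [RHS]exchange_big leaf_part_sum /=; apply: eq_bigr => j _.
  exact: leaf_part_diamond.
apply: eq_big_nat => i ik.
rewrite (sum_antidiagonals (F := fun j m => leaf_part (pred1 i) (K j) ◇
  leaf_part (pred1 (k - i)%N) (K m))); last first.
  (* If j + m > k, then j > i or m > k - i, and the corresponding factor has too few leaves
     available. *)
  move=> j m jmk; case: (leqP j i) => [ji|/leaf_part_K_eq0 ->]; last first.
    exact: forest_diamond0l.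
  by rewrite [X in _ ◇ X]leaf_part_K_eq0 ?forest_diamond0r //; lia.
rewrite -(@leaf_sum_widen i k (andP ik).2).
rewrite -(@leaf_sum_widen (k - i) k) ?leq_subr // forest_diamond_suml.
by apply: eq_bigr => j _; rewrite forest_diamond_sumr.
Qed.

Lemma leaf_sum0 : leaf_sum 0 = 0.
Proof. by rewrite big_nat1 K0 leaf_part0. Qed.

Lemma leaf_part1_K1 : leaf_part (pred1 1%N) (K 1) = a *: Y.
Proof.
rewrite K1 leaf_partD !leaf_partZ forest_diamondUU !leaf_partU.
by rewrite leaves_join leaves_leaf /= scaler0 addr0.
Qed.

Lemma leaf_sum1 : leaf_sum 1 = a *: Y.
Proof.
by rewrite big_nat_recr //= big_nat1 K0 leaf_part0 add0r leaf_part1_K1.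
Qed.

Lemma leaf_part_sum_k1 k : (2 <= k)%N ->
  leaf_part (pred1 k) (\sum_(0 <= n < k.+1 | n == 1%N)
     (a *: Y + b *: (Y ◇ Y))) = if k == 2 then b *: (Y ◇ Y) else 0.
Proof.
move=> k2; rewrite -big_filter.
have -> : [seq i <- index_iota 0 k.+1 | i == 1%N] = [:: 1%N].
  have -> : index_iota 0 k.+1 = [:: 0, 1 & index_iota 2 k.+1]%N.
    by case: k k2 => [|[|k]].
  rewrite /= (eq_in_filter (a2 := pred0)) ?filter_pred0 // => i.
  by rewrite mem_index_iota /=; lia.
rewrite big_seq1 leaf_partD !leaf_partZ forest_diamondUU !leaf_partU.
rewrite leaves_join leaves_leaf /= ifF ?scaler0 ?add0r; last by lia.
by rewrite eq_sym; case: ifP; rewrite ?scaler0.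
Qed.

Lemma G_characterization (s : nat -> forest R) :
  s 0 = 0 -> s 1 = a *: Y ->
  (forall k, (2 <= k)%N ->
     s k = (if k == 2 then b *: (Y ◇ Y) else 0)
           + 2^-1 *: (\sum_(0 <= i < k.+1) s i ◇ s (k - i)%N)) ->
  forall k, (2 <= k)%N -> G k = s k.
Proof.
move=> s0 s1 s_rec; elim/ltn_ind => -[|[|[|k]]] // IH _.
  (* At k = 2 only the index 1 survives in the sum: half of (a Y) ◇ (a Y) supplies the a^2/2 that
     joins b. *)
  rewrite (s_rec 2 isT) 2?big_nat_recr ?big_nat1; try by [].
  rewrite /= subn0 subnn (_ : 2 - 1 = 1)%N; last by [].
  rewrite s0 s1 forest_diamond0l forest_diamond0r G2 addr0 add0r.
  rewrite !forest_diamondE !scalerA -scalerDl; congr (_ *: _).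
  by field.
rewrite (s_rec k.+3 isT) /= add0r.
(* The two indices at each end are split off; what is left, 2 <= i < k.+2, is the range in the
   recursion of G. *)
rewrite big_ltn; last by [].
rewrite big_ltn; last by [].
rewrite big_nat_recr; last by [].
rewrite big_nat_recr; last by [].
rewrite /= subn0 subnn s0 forest_diamond0l forest_diamond0r addr0 add0r.
rewrite (_ : k.+3 - k.+2 = 1)%N; last by lia.
rewrite (_ : k.+3 - 1 = k.+2)%N; last by lia.
rewrite s1 -(IH k.+2 (ltnSn _) isT) (G_rec (k := k.+3) isT) /=.
rewrite forest_diamondZl forest_diamondZr (forest_diamondC (G k.+2)) addrCA.
have -> : \sum_(2 <= i < k.+2) s i ◇ s (k.+3 - i)%N =
          \sum_(2 <= j < k.+2) G (k.+3 - j)%N ◇ G j.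
  apply: eq_big_nat => j jk; rewrite forest_diamondC.
  by rewrite (IH j) ?(IH (k.+3 - j)%N); [|lia..].
rewrite half_plus_twice; reflexivity.
Qed.

Lemma G_sum_leaf_part_K k : (2 <= k)%N ->
  G k = \sum_(1 <= n < k.+1) leaf_part (pred1 k) (K n).
Proof.
move=> k2.
rewrite (G_characterization (s := fun k => leaf_sum k) leaf_sum0 leaf_sum1) //.
  by rewrite big_ltn // K0 leaf_part0 add0r.
by move=> m m2; rewrite leaf_sum_rec leaf_part_sum_k1.
Qed.

End Reordering.

(** * Conditional expectation on a sub-sigma-algebra *)

Section MeasurableWrt.
Context {R : realType} {d : measure_display} {Omega : measurableType d}.
Variable G : set (set Omega).
Hypothesis sG : sigma_algebra setT G.
Local Notation OmegaG := (g_sigma_algebraType G).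
Implicit Types X Z : Omega -> R.

(** A sigma-algebra generates itself, so [G] can serve as the measurable structure of a type and the
    general theory of measurable functions applies. *)
Lemma measurable_wrtP X :
  measurable_wrt G X <-> measurable_fun setT (X : OmegaG -> R).
Proof.
split=> [mX _ B mB|mX B mB].
  by rewrite setTI; apply: sub_sigma_algebra; exact: mX.
by have := mX measurableT B mB; rewrite setTI measurable_g_measurableTypeE.
Qed.

Lemma measurable_wrt_lincomb (a b : R) X Z :
  measurable_wrt G X -> measurable_wrt G Z ->
  measurable_wrt G (fun w => a * X w + b * Z w).
Proof.
move=> /measurable_wrtP mX /measurable_wrtP mZ; apply/measurable_wrtP.
by apply: measurable_funD; apply: measurable_funM.
Qed.

Hypothesis Gm : G `<=` measurable.

Lemma measurable_wrt_fun X : measurable_wrt G X -> measurable_fun setT X.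
Proof. by move=> mX _ B mB; rewrite setTI; exact/Gm/mX. Qed.

Lemma measurable_idG : measurable_fun setT (id : Omega -> OmegaG).
Proof.
by move=> _ B; rewrite setTI measurable_g_measurableTypeE // => /Gm.
Qed.

Section ConditionalExpectation.
Variable P : probability Omega R.

Lemma integrable_rv_lincomb (a b : R) X Z :
  integrable_rv P X -> integrable_rv P Z ->
  integrable_rv P (fun w => a * X w + b * Z w).
Proof.
move=> iX iZ; rewrite /integrable_rv.
have -> : EFin \o (fun w => a * X w + b * Z w) =
    (fun w => a%:E * (X w)%:E + b%:E * (Z w)%:E)%E.
  by apply/funext => w /=; rewrite EFinD !EFinM.
by apply: integrableD => //; apply: integrableZl.
Qed.

Lemma integral_lincomb (a b : R) X Z A : measurable A ->
  integrable_rv P X -> integrable_rv P Z ->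
  (\int[P]_(w in A) (a * X w + b * Z w)%:E =
   a%:E * \int[P]_(w in A) (X w)%:E + b%:E * \int[P]_(w in A) (Z w)%:E)%E.
Proof.
move=> mA iX iZ.
have iXA : P.-integrable A (EFin \o X) by exact: integrableS iX.
have iZA : P.-integrable A (EFin \o Z) by exact: integrableS iZ.
under eq_integral do rewrite EFinD !EFinM.
rewrite integralD//; [|exact: integrableZl..].
by rewrite !integralZl.
Qed.

Lemma is_condexp_lincomb (a b : R) X X' Z Z' :
  is_condexp P G X Z -> is_condexp P G X' Z' ->
  is_condexp P G (fun w => a * X w + b * X' w) (fun w => a * Z w + b * Z' w).
Proof.
move=> [iX iZ mZ eZ] [iX' iZ' mZ' eZ']; split.
- exact: integrable_rv_lincomb.
- exact: integrable_rv_lincomb.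
- exact: measurable_wrt_lincomb.
move=> A GA; rewrite !integral_lincomb //; try exact: Gm.
by rewrite eZ // eZ'.
Qed.

(** Measurability of [X'] is a hypothesis because [P] is not assumed complete. *)
Lemma integrable_rv_ae X X' : {ae P, forall w, X w = X' w} ->
  measurable_fun setT X' -> integrable_rv P X -> integrable_rv P X'.
Proof.
move=> XX' mX' iX; have mX := measurable_int _ iX.
have mX'E : measurable_fun setT (EFin \o X') by exact/measurable_EFinP.
apply/integrableP; split=> //; case/integrableP: iX => _.
rewrite (ae_eq_integral (abse \o (EFin \o X')))//.
- exact: measurableT_comp.
- exact: measurableT_comp.
- by apply: filterS XX' => w e _ /=; rewrite e.
Qed.

Lemma is_condexp_ae X X' Z : {ae P, forall w, X w = X' w} ->
  measurable_fun setT X' -> is_condexp P G X Z -> is_condexp P G X' Z.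
Proof.
move=> XX' mX' [iX iZ mZ eZ]; split=> //; first exact: integrable_rv_ae iX.
have mX := measurable_int _ iX.
have mX'E : measurable_fun setT (EFin \o X') by exact/measurable_EFinP.
move=> A GA; have mA := Gm GA.
rewrite eZ //; apply: ae_eq_integral => //; try exact: measurable_funTS.
by apply: filterS XX' => w e _ /=; rewrite e.
Qed.

(** The inclusion of [G] in the full sigma-algebra is measurability of the identity, and the law
    [PG] of this map is the restriction of [P] to [G]. *)
Let idG_mixin := isMeasurableFun.Build _ _ _ _ _ measurable_idG.
Let idG : {mfun Omega >-> OmegaG} :=
  MeasurableFun.Pack (MeasurableFun.Class idG_mixin).
Local Notation PG := (distribution P idG).

Let integrable_PG (f : OmegaG -> \bar R) : measurable_fun setT f ->
  P.-integrable setT (f : Omega -> \bar R) <-> PG.-integrable setT f.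
Proof.
move=> mf; split=> [i|/integrableP[_ lt_f]].
  exact: (@integrable_pushforward _ _ _ _ _ _ measurable_idG P setT f mf i).
apply/integrableP; split.
  exact: measurable_comp measurableT _ mf measurable_idG.
have mabs : measurable_fun setT (abse \o f) by exact: measurableT_comp.
by have := @ge0_integral_pushforward _ _ _ _ _ _ measurable_idG P setT _
  measurableT mabs (fun=> fun=> abse_ge0 _); rewrite preimage_setT => <-.
Qed.

Let integral_PG (f : OmegaG -> \bar R) A : measurable_fun setT f ->
  P.-integrable setT (f : Omega -> \bar R) -> G A ->
  (\int[P]_(w in A) f w = \int[PG]_(w in A) f w)%E.
Proof.
move=> mf intf GA.
have iA : P.-integrable (id @^-1` A) (f \o (id : Omega -> OmegaG)).
  by apply: integrableS intf => //; exact: Gm.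
have := @integral_pushforward _ _ _ _ _ _ measurable_idG P A f mf iA.
have mA : measurable (A : set OmegaG) by exact: sub_sigma_algebra.
by move=> /(_ mA) ->.
Qed.

(** Functions measurable for [G] with equal integrals over all sets of [G] agree almost everywhere
    for [PG]; the exceptional set lies in [G] and is therefore null for [P]. *)
Lemma is_condexp_unique X Z Z' :
  is_condexp P G X Z -> is_condexp P G X Z' -> {ae P, forall w, Z w = Z' w}.
Proof.
move=> [_ iZ /measurable_wrtP mZ eZ] [_ iZ' /measurable_wrtP mZ' eZ'].
have mZE : measurable_fun setT (EFin \o Z : OmegaG -> \bar R).
  exact/measurable_EFinP.
have mZE' : measurable_fun setT (EFin \o Z' : OmegaG -> \bar R).
  exact/measurable_EFinP.
have [] := @integral_ae_eq _ OmegaG R PG setT measurableT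
  (EFin \o Z') (EFin \o Z).
- exact/integrable_PG.
- by [].
- move=> A _; rewrite measurable_g_measurableTypeE // => GA.
  by rewrite -!integral_PG //; rewrite eZ // eZ'.
move=> B [mB B0 sB]; exists B; split=> //.
  by move: mB; rewrite measurable_g_measurableTypeE // => /Gm.
move=> w ZZ'; apply: sB => /= /(_ Logic.I) [] ZE; exact: ZZ'.
Qed.

Lemma is_condexp_exists X : integrable_rv P X -> exists Z, is_condexp P G X Z.
Proof.
move=> iX.
(* The signed measure sending A to the integral of [X] over A, restricted to [G]. *)
pose nu : {charge set OmegaG -> \bar R} :=
  measure_function_pushforward__canonical__charge_Charge (induced_charge iX)
    measurable_idG.
have nuP : nu `<< PG.
  have iP : induced_charge iX `<< P.
    apply/null_content_dominatesP => A mA PA; apply: null_set_integral => //.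
    exact/measurable_funTS/(measurable_int _ iX).
  exact: (dominates_pushforward measurable_idG iP).
pose Z : Omega -> R := fine \o Radon_Nikodym nu PG.
have ZE : EFin \o Z = Radon_Nikodym nu PG.
  by apply/funext => w /=; rewrite fineK // Radon_Nikodym_fin_num.
have iRN : PG.-integrable setT (Radon_Nikodym nu PG).
  exact: Radon_Nikodym_integrable.
have mRN := measurable_int _ iRN.
have iZ : integrable_rv P Z by rewrite /integrable_rv ZE; exact/integrable_PG.
exists Z; split=> //.
  by apply/measurable_wrtP/measurable_EFinP; rewrite ZE.
move=> A GA; transitivity (\int[P]_(w in A) Radon_Nikodym nu PG w)%E.
  by apply: eq_integral => w _; rewrite -ZE.
rewrite integral_PG //; last exact/integrable_PG.
by rewrite -Radon_Nikodym_integral //; exact: sub_sigma_algebra.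
Qed.

End ConditionalExpectation.
End MeasurableWrt.

(** * Convergence in probability and partitions *)

Section ConvergenceInProbability.
Context {R : realType} {d : measure_display} {Omega : measurableType d}.
Variable P : probability Omega R.
Implicit Types (U : nat -> Omega -> R) (V X : Omega -> R).

Lemma measurable_deviation X (e : R) : measurable_fun setT X ->
  measurable [set w | e <= `|X w|].
Proof.
move=> mX; rewrite (_ : [set w | _] = (Num.norm \o X) @^-1` `[e, +oo[).
  by rewrite -[_ @^-1` _]setTI; apply: measurableT_comp.
by apply/seteqP; split=> w /=; rewrite in_itv /= andbT.
Qed.

Lemma probability_le_ae (A B : set Omega) : measurable A -> measurable B ->
  {ae P, forall w, A w -> B w} -> (P A <= P B)%E.
Proof.
move=> mA mB [N [mN N0 sN]].
rewrite -(measureU0 mB mN N0); apply: le_measure.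
- exact: mem_set.
- exact/mem_set/measurableU.
move=> w Aw; case: (pselect (B w)) => [Bw|nBw]; [by left|right].
by apply: sN => /= /(_ Aw).
Qed.

Lemma cvg_in_probability_le U V U' V' :
  (forall n, measurable_fun setT (U n)) -> measurable_fun setT V ->
  (forall n, measurable_fun setT (U' n)) -> measurable_fun setT V' ->
  (forall n, {ae P, forall w, `|U' n w - V' w| <= `|U n w - V w|}) ->
  cvg_in_probability P U V -> cvg_in_probability P U' V'.
Proof.
move=> mU mV mU' mV' le_dev UV e e0.
apply: squeeze_cvge (cvg_cst 0%E) (UV e e0); apply: nearW => n.
rewrite measure_ge0 /=; apply: probability_le_ae.
- exact/measurable_deviation/measurable_funB.
- exact/measurable_deviation/measurable_funB.
by apply: filterS (le_dev n) => w le_w /= /le_trans; apply.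
Qed.

Lemma cvg_in_probability_lincomb (a b : R) U V U' V' :
  (forall n, measurable_fun setT (U n)) -> measurable_fun setT V ->
  (forall n, measurable_fun setT (U' n)) -> measurable_fun setT V' ->
  cvg_in_probability P U V -> cvg_in_probability P U' V' ->
  cvg_in_probability P (fun n w => a * U n w + b * U' n w)
    (fun w => a * V w + b * V' w).
Proof.
move=> mU mV mU' mV' UV UV' e e0.
(* With these thresholds |a| ea + |b| eb < e; the added 1 avoids a division by zero. *)
pose ea := e / 2 / (`|a| + 1); pose eb := e / 2 / (`|b| + 1).
have ea0 : 0 < ea by rewrite !divr_gt0 // ltr_wpDl.
have eb0 : 0 < eb by rewrite !divr_gt0 // ltr_wpDl.
pose A n := [set w | ea <= `|U n w - V w|].
pose B n := [set w | eb <= `|U' n w - V' w|].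
have lim0 : (P (A n) + P (B n))%E @[n --> \oo] --> 0%E.
  rewrite -[X in _ --> X]adde0.
  by apply: cvgeD => //; [exact: UV|exact: UV'].
apply: squeeze_cvge (cvg_cst 0%E) lim0; apply: nearW => n.
have mA : measurable (A n).
  exact/measurable_deviation/measurable_funB.
have mB : measurable (B n).
  exact/measurable_deviation/measurable_funB.
rewrite measure_ge0 /=; apply: le_trans (measureU2 P mA mB).
apply: le_measure; last first.
  move=> w /= e_le; apply: contrapT => /not_orP[] /negP + /negP.
  rewrite /A /B /= -!ltNge => ltA ltB; move: e_le; apply/negP; rewrite -ltNge.
  have -> : a * U n w + b * U' n w - (a * V w + b * V' w) =
            a * (U n w - V w) + b * (U' n w - V' w) by ring.
  apply: le_lt_trans (ler_normD _ _) _; rewrite !normrM.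
  have leA : `|a| * `|U n w - V w| <= `|a| * ea by rewrite ler_wpM2l // ltW.
  have leB : `|b| * `|U' n w - V' w| <= `|b| * eb by rewrite ler_wpM2l // ltW.
  have eaE : (`|a| + 1) * ea = e / 2.
    by rewrite /ea mulrCA divff ?mulr1 // gt_eqF // ltr_wpDl.
  have ebE : (`|b| + 1) * eb = e / 2.
    by rewrite /eb mulrCA divff ?mulr1 // gt_eqF // ltr_wpDl.
  move: eaE ebE; lra.
- exact/mem_set/measurableU.
- apply/mem_set/measurable_deviation/measurable_funB; apply: measurable_funD;
    by apply: measurable_funM.
Qed.

Lemma cvg_in_probability_unique U V V' :
  (forall n, measurable_fun setT (U n)) -> measurable_fun setT V ->
  measurable_fun setT V' ->
  cvg_in_probability P U V -> cvg_in_probability P U V' ->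
  {ae P, forall w, V w = V' w}.
Proof.
move=> mU mV mV' UV UV'.
have mD : measurable_fun setT (fun w => V w - V' w) by exact: measurable_funB.
have dev0 e : 0 < e -> P [set w | e <= `|V w - V' w|] = 0%E.
  move=> e0.
  (* The difference of the sequence with itself is zero, so the probability of a deviation is
     constant in n and equals its limit 0. *)
  have := cvg_in_probability_lincomb 1 (-1)
    mU mV mU mV' UV UV' e0.
  rewrite (_ : (fun n => P _) = (cst (P [set w | e <= `|V w - V' w|]))).
    move=> h; rewrite -(cvg_lim _ h) // (cvg_lim _ (cvg_cst _)) //.
  apply/funext => n /=; congr (P _); apply/funext => w /=; congr (_ <= _).
  by rewrite !mulN1r !mul1r subrr sub0r normrN.
have : P.-negligible (\bigcup_n [set w | n.+1%:R^-1 <= `|V w - V' w|]).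
  apply: negligible_bigcup => n.
  by apply/negligibleP; [exact: measurable_deviation|exact: dev0].
apply: negligibleS => w /= ne.
have /eqP := ne; rewrite -subr_eq0 -normr_gt0 => dev_gt0.
have [n _ n_lt] := near_infty_natSinv_lt (PosNum dev_gt0).
exists n => //=; apply: ltW; exact: (n_lt n (leqnn n)).
Qed.

(** Convergence makes the upper limit of the deviation events null; by continuity from above, so do
    the probabilities of their tail unions tend to 0. *)
Lemma ae_cvg_in_probability U V :
  (forall n, measurable_fun setT (U n)) -> measurable_fun setT V ->
  {ae P, forall w, U n w @[n --> \oo] --> V w} -> cvg_in_probability P U V.
Proof.
move=> mU mV UV e e0.
pose E n := [set w | e <= `|U n w - V w|].
have mE n : measurable (E n) by exact/measurable_deviation/measurable_funB.
have limE : P (lim_sup_set E) = 0%E.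
  apply/negligibleP.
    by apply: bigcap_measurable => // n _; exact: bigcup_measurable.
  apply: negligibleS UV => w Ew /= cvg_w.
  have /cvgrPdist_lt /(_ _ e0) [N _ ltN] := cvg_w.
  have [n /= Nn] := Ew N Logic.I; rewrite /E /= distrC leNgt.
  by rewrite (ltN n Nn).
have tail : P (\bigcup_(k >= n) E k) @[n --> \oo] --> 0%E.
  rewrite -limE; apply: lim_sup_set_cvg => //.
  apply: le_lt_trans (ltry 1); apply: probability_le1.
  exact: bigcup_measurable.
apply: squeeze_cvge (cvg_cst 0%E) tail; apply: nearW => n.
rewrite measure_ge0 /=; apply: le_measure.
- exact/mem_set/mE.
- by apply/mem_set/bigcup_measurable => k _; exact: mE.
by move=> w Ew; exists n => /=.
Qed.

End ConvergenceInProbability.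

Section Partitions.
Context {R : realType}.
Implicit Types (f g : R -> R) (s : seq R).

Lemma itv_partition_nth (t : R) s i : itv_partition 0 t s ->
  (i <= size s)%N -> 0 <= (0 :: s)`_i <= t.
Proof.
move=> ps si; have si' : (i < (size s).+1)%N by [].
rewrite (set_nth_default t) //.
by rewrite (itv_partition_nth_ge si' ps) (itv_partition_nth_le si' ps).
Qed.

Lemma le_mesh s i : (i < size s)%N -> (0 :: s)`_i.+1 - (0 :: s)`_i <= mesh s.
Proof.
move=> si; exact: (@le_bigmax_cond _ _ _ _ (Ordinal si) xpredT
  (fun i : 'I_(size s) => (0 :: s)`_i.+1 - (0 :: s)`_i)).
Qed.

(** The condition defining a bracket ranges over all sequences of partitions; uniqueness of the
    bracket requires that there be one. *)
Lemma itv_partitions_exist (t : R) : 0 <= t ->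
  exists p : nat -> seq R,
    (forall n, itv_partition 0 t (p n)) /\ mesh (p n) @[n --> \oo] --> (0 : R).
Proof.
rewrite le_eqVlt => /predU1P[<-|t0].
  (* Partition points increase strictly from 0, so for t = 0 the partition is empty. *)
  exists (fun=> [::]); split=> [n|]; first by split.
  by rewrite /mesh; under eq_fun do rewrite big_ord0; exact: cvg_cst.
pose q n i : R := t * i%:R / n.+1%:R.
pose p n := [seq q n i | i <- iota 1 n.+1].
have qE n i : (i <= n.+1)%N -> (0 :: p n)`_i = q n i.
  case: i => [|i] si /=; first by rewrite /q mulr0 mul0r.
  by rewrite (nth_map 0%N) ?size_iota // nth_iota.
exists p; split=> [n|].
  split; last first.
    rewrite (last_nth 0) size_map size_iota qE //.
    by rewrite /q mulfK // pnatr_eq0.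
  apply/(pathP 0) => i; rewrite size_map size_iota => si.
  rewrite (_ : (p n)`_i = (0 :: p n)`_i.+1) // !qE //; last exact: ltnW.
  by rewrite /q ltr_pM2r ?invr_gt0 // ltr_pM2l // ltr_nat.
apply: (@squeeze_cvgr _ _ _ _ (fun=> 0) (fun n => t * n.+1%:R^-1)).
- apply: nearW => n; apply/andP; split.
    by apply: bigmax_ge_id.
  apply: bigmax_le => [|i _]; first by rewrite mulr_ge0 ?invr_ge0 // ltW.
  have si : (i < n.+1)%N.
    by rewrite (leq_trans (ltn_ord i)) // size_map size_iota.
  rewrite !qE //; last exact: ltnW.
  by rewrite /q -mulrBl -mulrBr -natrB // subSnn mulr1.
- exact: cvg_cst.
- rewrite -[X in _ --> X](mulr0 t); apply: cvgMr; exact: cvg_harmonic.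
Qed.

(** Heine-Cantor for the subspace topology: the covering form of compactness turns a radius around
    each point into a common one. *)
Lemma uniformly_continuous_itv (T : R) g : {within `[0, T], continuous g} ->
  forall e, 0 < e -> \forall r \near (0 : R)^'+,
    forall x y, 0 <= x <= T -> 0 <= y <= T -> `|x - y| <= r ->
    `|g x - g y| < e.
Proof.
move=> cg e e0.
have cpt : compact `[0, T] by exact: segment_compact.
have /compact_near_coveringP near_cpt := cpt.
suff osc : \forall r \near (0 : R)^'+, `[0, T]%classic `<=`
    (fun x => forall y, 0 <= x <= T -> 0 <= y <= T -> `|x - y| <= r ->
      `|g x - g y| < e).
  by apply: filterS osc => r rP x y xT; apply: rP => //=; rewrite in_itv.
apply: near_cpt => x /= xT.
have e2 : 0 < e / 2 by rewrite divr_gt0.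
have /cvgrPdist_lt /(_ _ e2) := iffLR (@subspace_continuousP _ _ _ _) cg x xT.
rewrite near_withinE => /nbhs_ballP[r /= r0 gr].
have r2 : 0 < r / 2 by rewrite divr_gt0.
near=> x' r' => /= y x'T yT x'y.
have xx' : `|x - x'| < r / 2.
  by near: x'; exact: (nbhsx_ballx x _ r2).
have r'r : r' < r / 2 by near: r'; exact: nbhs_right_lt.
have gx' : `|g x - g x'| < e / 2.
  by apply: gr; rewrite /= ?in_itv // /ball /= (lt_trans xx') //; lra.
have gy : `|g x - g y| < e / 2.
  have xy : `|x - y| < r.
    apply: le_lt_trans (ler_distD x' _ _) _; move: xx' r'r x'y; lra.
  by apply: gr; rewrite /= ?in_itv.
apply: le_lt_trans (ler_distD (g x) _ _) _; rewrite distrC.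
move: gx' gy; lra.
Unshelve. all: by end_near.
Qed.

(* A finite-variation path times a continuous path: the sum is at most the
   total variation times the oscillation at the scale of the mesh. *)
Lemma bounded_variation_cov_sum_cvg0 (T t : R) f g (p : nat -> seq R) :
  0 <= t <= T -> bounded_variation 0 T f -> {within `[0, T], continuous g} ->
  (forall n, itv_partition 0 t (p n)) ->
  mesh (p n) @[n --> \oo] --> (0 : R) ->
  \sum_(i < size (p n)) (f (0 :: p n)`_i.+1 - f (0 :: p n)`_i) *
    (g (0 :: p n)`_i.+1 - g (0 :: p n)`_i) @[n --> \oo] --> (0 : R).
Proof.
move=> /andP[t0 tT] bvT cg pt mp.
have [M leM] : bounded_variation 0 t f by exact: bounded_variationl bvT.
pose M' := `|M| + 1.
have M'0 : 0 < M' by rewrite ltr_wpDl.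
apply/cvgrPdist_le => e e0.
have eM : 0 < e / M' by rewrite divr_gt0.
have [r /= r0 rP] := uniformly_continuous_itv cg eM.
have r2 : 0 < r / 2 by rewrite divr_gt0.
have {}rP : forall x y, 0 <= x <= T -> 0 <= y <= T -> `|x - y| <= r / 2 ->
    `|g x - g y| < e / M'.
  apply: (rP (r / 2)) => //=.
  by rewrite sub0r normrN gtr0_norm // ltr_pdivrMr // ltr_pMr // ltr1n.
have /cvgrPdist_lt /(_ _ r2) := mp.
apply: filterS => n; rewrite !sub0r !normrN => mesh_lt.
rewrite (le_trans (ler_norm_sum _ _ _)) //.
apply: (@le_trans _ _ (\sum_(i < size (p n))
    `|f (0 :: p n)`_i.+1 - f (0 :: p n)`_i| * (e / M'))).
  apply: ler_sum => i _; rewrite normrM ler_wpM2l //.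
  have in0T j : (j <= size (p n))%N -> 0 <= (0 :: p n)`_j <= T.
    by move=> /(itv_partition_nth (pt n)) /andP[-> /= /le_trans ->].
  have := ltn_ord i => si.
  apply/ltW/rP; [exact: (in0T i.+1 si)|exact: (in0T i (ltnW si))|].
  have sorted_le : (0 :: p n)`_i <= (0 :: p n)`_i.+1.
    have [/(pathP 0) + _] := pt n.
    by move=> /(_ i si) /ltW.
  rewrite ger0_norm ?subr_ge0 //.
  apply: le_trans (le_mesh si) _; apply: ltW.
  exact: le_lt_trans (ler_norm _) mesh_lt.
rewrite -mulr_suml.
have varE : \sum_(i < size (p n)) `|f (0 :: p n)`_i.+1 - f (0 :: p n)`_i| =
    variation 0 t f (p n).
  rewrite /variation /= big_mkord; apply: eq_bigr => i _ /=.
  have := ltn_ord i => si; congr (`|f _ - f _|); apply: set_nth_default => //=.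
  exact: ltnW.
rewrite varE mulrA ler_pdivrMr // mulrC ler_pM2l //.
apply: (@le_trans _ _ M); first by apply: leM; exact: variations_variation.
by rewrite /M' (le_trans (ler_norm _)) // lerDl.
Qed.

Lemma bounded_variationZ (c T : R) f :
  bounded_variation 0 T f -> bounded_variation 0 T (fun x => c * f x).
Proof.
move=> [M leM]; exists (`|c| * M) => _ [s ps <-].
have -> : variation 0 T (fun x => c * f x) s = `|c| * variation 0 T f s.
  rewrite /variation mulr_sumr; apply: eq_bigr => i _ /=.
  by rewrite -mulrBr normrM.
by rewrite ler_wpM2l // leM //; exact: variations_variation.
Qed.

End Partitions.

(** * Covariation and the diamond product *)

Section Covariation.
Context {R : realType} {d : measure_display} {Omega : measurableType d}.
Variables (P : probability Omega R) (T : R) (F : R -> set (set Omega)).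
Hypothesis T_gt0 : 0 < T.
Hypothesis filtF : filtration T F.

Local Notation process := (R -> Omega -> R).
Implicit Types X Z C V : process.

Let sF t : 0 <= t <= T -> sigma_algebra setT (F t).
Proof. by move=> tT; have [/(_ t tT)[]] := filtF. Qed.

Let Fm t : 0 <= t <= T -> F t `<=` measurable.
Proof. by move=> tT; have [/(_ t tT)[]] := filtF. Qed.

Let Fle s t : 0 <= s -> s <= t -> t <= T -> F s `<=` F t.
Proof. by have [_] := filtF; apply. Qed.

Let T_itv : 0 <= T <= T.
Proof. by rewrite lexx ltW. Qed.

Definition adapted_continuous X : Prop := adapted T F X /\ continuous_paths P T X.

Lemma adapted_measurable X t : adapted T F X -> 0 <= t <= T ->
  measurable_fun setT (X t).
Proof. by move=> aX tT; apply: (measurable_wrt_fun (Fm tT)); exact: aX. Qed.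

Definition lincomb (a b : R) X Z : process := fun t w => a * X t w + b * Z t w.

Lemma adapted_lincomb a b X Z :
  adapted T F X -> adapted T F Z -> adapted T F (lincomb a b X Z).
Proof.
move=> aX aZ t tT.
exact: (measurable_wrt_lincomb (sF tT) a b (aX t tT) (aZ t tT)).
Qed.

Lemma continuous_paths_lincomb a b X Z :
  continuous_paths P T X -> continuous_paths P T Z ->
  continuous_paths P T (lincomb a b X Z).
Proof.
move=> cX cZ; apply: filterS2 cX cZ => w cXw cZw x.
by apply: cvgD; apply: cvgMr; [exact: cXw|exact: cZw].
Qed.

Lemma adapted_continuous_lincomb a b X Z :
  adapted_continuous X -> adapted_continuous Z ->
  adapted_continuous (lincomb a b X Z).
Proof.
move=> [aX cX] [aZ cZ]; split; first exact: adapted_lincomb.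
exact: continuous_paths_lincomb.
Qed.

Lemma bounded_variation_paths_lincomb a b X Z :
  bounded_variation_paths P T X -> bounded_variation_paths P T Z ->
  bounded_variation_paths P T (lincomb a b X Z).
Proof.
move=> bX bZ; apply: filterS2 bX bZ => w bXw bZw.
by apply: bounded_variationD => //; exact: bounded_variationZ.
Qed.

Lemma version_refl X : version P T X X.
Proof. by move=> t _; apply: nearW. Qed.

Lemma version_sym X Z : version P T X Z -> version P T Z X.
Proof. by move=> XZ t tT; apply: filterS (XZ t tT). Qed.

Lemma version_lincomb a b X X' Z Z' : version P T X X' -> version P T Z Z' ->
  version P T (lincomb a b X Z) (lincomb a b X' Z').
Proof.
move=> XX' ZZ' t tT; apply: filterS2 (XX' t tT) (ZZ' t tT) => w e e'.
by rewrite /lincomb e e'.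
Qed.

Lemma partition_time t s i : 0 <= t <= T -> itv_partition 0 t s ->
  (i <= size s)%N -> 0 <= (0 :: s)`_i <= T.
Proof.
move=> /andP[_ tT] ps /(itv_partition_nth ps) /andP[-> /=].
by move=> /le_trans; apply.
Qed.

Lemma measurable_cov_sum X Z t s : adapted T F X -> adapted T F Z ->
  0 <= t <= T -> itv_partition 0 t s -> measurable_fun setT (cov_sum X Z s).
Proof.
move=> aX aZ tT ps; apply: measurable_sum => i.
have si := ltn_ord i.
have t1 : 0 <= (0 :: s)`_i.+1 <= T by exact: (partition_time tT ps si).
have t0 : 0 <= (0 :: s)`_i <= T by exact: (partition_time tT ps (ltnW si)).
by apply: measurable_funM; apply: measurable_funB; exact: adapted_measurable.
Qed.

Lemma cov_sum_lincombl a b X X' Z s w :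
  cov_sum (lincomb a b X X') Z s w =
  a * cov_sum X Z s w + b * cov_sum X' Z s w.
Proof.
rewrite /cov_sum !mulr_sumr -big_split /=; apply: eq_bigr => i _.
by rewrite /lincomb; ring.
Qed.

(** Only the finitely many times of the partition matter, so the exceptional null sets can be
    united. *)
Lemma cov_sum_version X X' Z Z' t s : version P T X X' -> version P T Z Z' ->
  0 <= t <= T -> itv_partition 0 t s ->
  {ae P, forall w, cov_sum X Z s w = cov_sum X' Z' s w}.
Proof.
move=> XX' ZZ' tT ps.
have aeP i : (i <= size s)%N -> {ae P, forall w,
    X (0 :: s)`_i w = X' (0 :: s)`_i w /\ Z (0 :: s)`_i w = Z' (0 :: s)`_i w}.
  move=> /(partition_time tT ps) it.
  by apply: filterS2 (XX' _ it) (ZZ' _ it).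
have : {ae P, forall w, forall i : 'I_(size s).+1,
    X (0 :: s)`_i w = X' (0 :: s)`_i w /\ Z (0 :: s)`_i w = Z' (0 :: s)`_i w}.
  by apply: filter_forall => i; apply: aeP; rewrite -ltnS.
apply: filterS => w XZ; apply: eq_bigr => i _.
have [-> ->] := XZ (widen_ord (leqnSn _) i).
by have [-> ->] := XZ (lift ord0 i).
Qed.

Lemma measurable_wrt_cst t (c : R) : 0 <= t <= T ->
  measurable_wrt (F t) (fun=> c).
Proof. by move=> tT; apply/(measurable_wrtP (sF tT)); exact: measurable_cst. Qed.

Lemma adapted_continuous0 : adapted_continuous (fun _ _ => 0).
Proof.
split; first by move=> t tT; exact: measurable_wrt_cst.
by apply: nearW => w x; exact: cvg_cst.
Qed.

Lemma bounded_variation_paths0 : bounded_variation_paths P T (fun _ _ => 0).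
Proof.
apply: nearW => w; exists 0 => _ [s _ <-].
by rewrite /variation big1 // => i _; rewrite subrr normr0.
Qed.

Local Notation is_cov := (is_covariation P T F).

Lemma is_covariation_sym X Z C : is_cov X Z C -> is_cov Z X C.
Proof.
move=> [hX hZ hC bC lim]; split=> // t tT p pt mp.
have -> : cov_sum Z X = cov_sum X Z; last exact: lim.
by apply/funext => s; apply/funext => w; apply: eq_bigr => i _; rewrite mulrC.
Qed.

Lemma is_covariation_lincombl a b X X' Z C C' :
  is_cov X Z C -> is_cov X' Z C' ->
  is_cov (lincomb a b X X') Z (lincomb a b C C').
Proof.
move=> [hX hZ hC bC lim] [hX' _ hC' bC' lim']; split=> //.
- exact: adapted_continuous_lincomb.
- exact: adapted_continuous_lincomb.
- exact: bounded_variation_paths_lincomb.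
move=> t tT p pt mp.
rewrite (_ : (fun n => cov_sum _ _ (p n)) = (fun n w =>
    a * cov_sum X Z (p n) w + b * cov_sum X' Z (p n) w)); last first.
  by apply/funext => n; apply/funext => w; rewrite cov_sum_lincombl.
have [[[[[aX _] [aX' _]] [aZ _]] [aC _]] [aC' _]] := (hX, hX', hZ, hC, hC').
apply: cvg_in_probability_lincomb.
- by move=> n; exact: (measurable_cov_sum aX aZ tT (pt n)).
- exact: adapted_measurable.
- by move=> n; exact: (measurable_cov_sum aX' aZ tT (pt n)).
- exact: adapted_measurable.
- exact: lim.
- exact: lim'.
Qed.

Lemma is_covariation_unique X Z C C' :
  is_cov X Z C -> is_cov X Z C' -> version P T C C'.
Proof.
move=> [[aX _] [aZ _] [aC _] _ lim] [_ _ [aC' _] _ lim'] t tT.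
have [p [pt mp]] := itv_partitions_exist (proj1 (andP tT)).
apply: (cvg_in_probability_unique _ _ _ (lim t tT p pt mp) (lim' t tT p pt mp)).
- by move=> n; exact: (measurable_cov_sum aX aZ tT (pt n)).
- exact: adapted_measurable.
- exact: adapted_measurable.
Qed.

(** Versions agree almost everywhere at each fixed time only, so adaptedness and continuity of [X']
    are required separately. *)
Lemma is_covariation_versionl X X' Z C : adapted_continuous X' ->
  version P T X X' -> is_cov X Z C -> is_cov X' Z C.
Proof.
move=> hX' XX' [hX hZ hC bC lim]; split=> // t tT p pt mp.
have [[[[aX _] [aX' _]] [aZ _]] [aC _]] := (hX, hX', hZ, hC).
apply: cvg_in_probability_le (lim t tT p pt mp).
- by move=> n; exact: (measurable_cov_sum aX aZ tT (pt n)).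
- exact: adapted_measurable.
- by move=> n; exact: (measurable_cov_sum aX' aZ tT (pt n)).
- exact: adapted_measurable.
move=> n; have := cov_sum_version XX' (@version_refl Z) tT (pt n).
by apply: filterS => w ->.
Qed.

(** The sums tend to 0 along almost every path, hence in probability. *)
Lemma is_covariation_bounded_variation V Z :
  adapted_continuous V -> bounded_variation_paths P T V ->
  adapted_continuous Z -> is_cov V Z (fun _ _ => 0).
Proof.
move=> hV bV hZ; split=> //; [exact: adapted_continuous0|
  exact: bounded_variation_paths0|].
move=> t tT p pt mp; have [[aV _] [aZ cZ]] := (hV, hZ).
apply: ae_cvg_in_probability.
- by move=> n; exact: (measurable_cov_sum aV aZ tT (pt n)).
- exact: measurable_cst.
apply: filterS2 bV cZ => w bVw cZw.
exact: (bounded_variation_cov_sum_cvg0 tT bVw cZw pt mp).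
Qed.

Lemma is_covariation_plus_bounded_variation X V Z C :
  adapted_continuous V -> bounded_variation_paths P T V ->
  is_cov X Z C -> is_cov (lincomb 1 1 X V) Z C.
Proof.
move=> hV bV covXZ; have [_ hZ _ _ _] := covXZ.
have := is_covariation_lincombl 1 1 covXZ
  (is_covariation_bounded_variation hV bV hZ).
rewrite (_ : lincomb 1 1 C _ = C) //.
by apply/funext => t; apply/funext => w; rewrite /lincomb mulr0 addr0 mul1r.
Qed.

Definition process_sum (I : Type) (r : seq I) (a : I -> R) (X : I -> process) :
    process :=
  fun t w => \sum_(i <- r) a i * X i t w.

Lemma process_sum_cons (I : Type) (i : I) r a (X : I -> process) :
  process_sum (i :: r) a X = lincomb (a i) 1 (X i) (process_sum r a X).
Proof.
apply/funext => t; apply/funext => w.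
by rewrite /process_sum big_cons /lincomb mul1r.
Qed.

Lemma process_sum_nil (I : Type) a (X : I -> process) :
  process_sum ([::] : seq I) a X = (fun _ _ => 0).
Proof.
by apply/funext => t; apply/funext => w; rewrite /process_sum big_nil.
Qed.

Lemma is_covariation_suml (I : Type) (r : seq I) a (X C : I -> process) Z :
  adapted_continuous Z -> (forall i, is_cov (X i) Z (C i)) ->
  is_cov (process_sum r a X) Z (process_sum r a C).
Proof.
move=> hZ covXZ; elim: r => [|i r IH].
  rewrite !process_sum_nil; apply: is_covariation_bounded_variation => //.
    exact: adapted_continuous0.
  exact: bounded_variation_paths0.
by rewrite !process_sum_cons; exact: is_covariation_lincombl.
Qed.

Lemma is_condexp_sum (I : Type) t (r : seq I) (a : I -> R)
    (X Z : I -> Omega -> R) : 0 <= t <= T ->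
  (forall i, is_condexp P (F t) (X i) (Z i)) ->
  is_condexp P (F t) (fun w => \sum_(i <- r) a i * X i w)
    (fun w => \sum_(i <- r) a i * Z i w).
Proof.
move=> tT ceX; elim: r => [|i r IH].
  rewrite (_ : (fun w => _) = (fun=> 0)); last first.
    by apply/funext => w; rewrite big_nil.
  rewrite (_ : (fun w => \sum_(i <- [::]) _) = (fun=> 0)); last first.
    by apply/funext => w; rewrite big_nil.
  by split=> //; [exact: integrable0|exact: integrable0|
    exact: measurable_wrt_cst].
have E Q : (fun w => \sum_(j <- i :: r) a j * Q j w) =
    (fun w => a i * Q i w + 1 * \sum_(j <- r) a j * Q j w).
  by move=> *; apply/funext => w; rewrite big_cons mul1r.
by rewrite !E; apply: (is_condexp_lincomb (sF tT) (Fm tT)).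
Qed.

Lemma is_condexp_tower s t (X Z W : Omega -> R) :
  0 <= s -> s <= t -> t <= T ->
  is_condexp P (F t) X Z -> is_condexp P (F s) Z W -> is_condexp P (F s) X W.
Proof.
move=> s0 st tT [iX iZ _ eZ] [_ iW mW eW]; split=> // A FA.
by rewrite eW // eZ //; exact: (Fle s0 st tT).
Qed.

Hypothesis mart : martingales_have_continuous_versions P T F.

Lemma condexp_processP (X : Omega -> R) : integrable_rv P X ->
  is_condexp_process P T F X (condexp_process P T F X).
Proof.
move=> iX; suff : exists M, is_condexp_process P T F X M.
  by move=> ex; exact: (xgetPex _ ex).
have /choice[M ceM] t :
    exists Z : Omega -> R, 0 <= t <= T -> is_condexp P (F t) X Z.
  case: (pselect (0 <= t <= T)) => [tT|]; last by exists 0.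
  by have [Z ceZ] := is_condexp_exists (sF tT) (Fm tT) iX; exists Z.
have martM : martingale P T F M.
  move=> s t s0 st tT.
  have tT' : 0 <= t <= T by rewrite tT andbT (le_trans s0).
  have sT' : 0 <= s <= T by rewrite s0 (le_trans st).
  have [_ iMt _ eMt] := ceM t tT'; have [_ iMs mMs eMs] := ceM s sT'.
  split=> // A FA; rewrite eMs // eMt //; exact: (Fle s0 st tT).
have [M' [martM' cM' MM']] := mart martM.
exists M'; split=> // t /andP[t0 tT].
(* The martingale property of [M'] conditions [M' T], which is almost everywhere [M T], itself a
   conditional expectation of [X]. *)
apply: (is_condexp_tower t0 tT (lexx T) (ceM T T_itv)).
apply: (is_condexp_ae (Fm _) _ _ (martM' t T t0 tT (lexx T))).
- by rewrite t0.
- by apply: filterS (MM' T T_itv) => w ->.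
- have [_ _ mMT _] := ceM T T_itv; exact: (measurable_wrt_fun (Fm T_itv)).
Qed.

End Covariation.

(** * Processes pictured by forests *)

Section Pictures.
Context {R : realType} {d : measure_display} {Omega : measurableType d}.
Variables (P : probability Omega R) (T : R) (F : R -> set (set Omega)).
Variable YT : Omega -> R.
Hypothesis T_gt0 : 0 < T.
Hypothesis filtF : filtration T F.
Hypothesis mart : martingales_have_continuous_versions P T F.
Hypothesis intY : sufficiently_integrable P T F YT.

Local Notation process := (R -> Omega -> R).
Local Notation tp := (tree_process P T F YT).
Local Notation fp := (forest_process P T F YT).
Local Notation cov := (covariation P T F).
Local Notation is_cov := (is_covariation P T F).
Local Notation dia := (diamond P T F).
Local Notation adcont := (adapted_continuous P T F).
Local Notation YP := (Y_process P T F YT).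
Local Notation QV := (quadratic_variation P T F YT).
Implicit Types (X Z C V : process) (f g : forest R) (s t : tree).

Lemma forest_processE f : fp f = linext tp f.
Proof. by []. Qed.

Lemma linext_process_sum (phi : tree -> process) f :
  linext phi f = process_sum (msupp f) (fun s => mcoeff s f) phi.
Proof.
apply/funext => u; apply/funext => w; rewrite /linext /process_sum.
elim: (enum_fset (msupp f)) => [|s r IH]; first by rewrite !big_nil.
by rewrite !big_cons -IH.
Qed.

Lemma covariation_treeP s t : is_cov (tp s) (tp t) (cov (tp s) (tp t)).
Proof.
have [_ /(_ s t)[C [covC _]]] := intY.
by apply: (xgetPex (0 : process)); exists C.
Qed.

(** One bracket with integrable terminal value is enough: uniqueness transfers what is known of [C]
    to the chosen bracket and to its conditional expectations. *)
Lemma covariation_spec X Z C : is_cov X Z C -> integrable_rv P (C T) ->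
  [/\ is_cov X Z (cov X Z), version P T (cov X Z) C,
      continuous_paths P T (condexp_process P T F (cov X Z T)) &
      forall u, 0 <= u <= T ->
        is_condexp P (F u) (C T) (condexp_process P T F (cov X Z T) u)].
Proof.
move=> covC iC.
have covXZ : is_cov X Z (cov X Z).
  by apply: (xgetPex (0 : process)); exists C.
have vC := is_covariation_unique filtF covXZ covC.
have TT : 0 <= T <= T by rewrite lexx ltW.
have mC C' : is_cov X Z C' -> measurable_fun setT (C' T).
  by move=> [_ _ [aC' _] _ _]; exact: (adapted_measurable filtF aC' TT).
have icov : integrable_rv P (cov X Z T).
  by apply: integrable_rv_ae (version_sym vC TT) _ iC; exact: mC.
have [cM ceM] := condexp_processP T_gt0 filtF mart icov.
split=> // u uT.
have [/(_ u uT)[_ Fu] _] := filtF.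
by apply: (is_condexp_ae Fu (vC T TT) _ (ceM u uT)); exact: mC.
Qed.

Lemma adapted_continuous_diamond X Z C :
  is_cov X Z C -> integrable_rv P (C T) -> adcont (dia X Z).
Proof.
move=> covC iC; have [covXZ _ cM ceM] := covariation_spec covC iC.
have [_ _ acXZ _ _] := covXZ.
rewrite (_ : dia X Z = lincomb 1 (-1) (condexp_process P T F (cov X Z T))
  (cov X Z)).
  apply: adapted_continuous_lincomb => //; split=> // u uT.
  by have [] := ceM u uT.
apply/funext => u; apply/funext => w.
by rewrite /diamond /lincomb mul1r mulN1r.
Qed.

Lemma integrable_covariation_tree s t : integrable_rv P (cov (tp s) (tp t) T).
Proof.
have [_ /(_ s t)[C [covC iC]]] := intY.
have [_ vC _ _] := covariation_spec covC iC.
have TT : 0 <= T <= T by rewrite lexx ltW.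
have [_ _ [acov _] _ _] := covariation_treeP s t.
have [_ _ [aC _] _ _] := covC.
apply: integrable_rv_ae (version_sym vC TT) _ iC.
exact: (adapted_measurable filtF acov TT).
Qed.

(** The existence of the bracket of a process with itself already includes these properties. *)
Lemma adapted_continuous_tree s : adcont (tp s).
Proof. by have [] := covariation_treeP s s. Qed.

Lemma adapted_continuous_forest f : adcont (fp f).
Proof.
rewrite forest_processE linext_process_sum.
elim: (enum_fset (msupp f)) => [|s r IH].
  by rewrite process_sum_nil; exact: adapted_continuous0.
rewrite process_sum_cons; apply: adapted_continuous_lincomb => //.
exact: adapted_continuous_tree.
Qed.

Local Notation cov_forest f g :=
  (process_sum (msupp f) (fun s => mcoeff s f)
    (fun s => process_sum (msupp g) (fun t => mcoeff t g)
      (fun t => cov (tp s) (tp t)))).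

(** This is the explicit witness that a bracket of forests exists, built from the brackets assumed
    for pairs of trees. *)
Lemma is_covariation_forest f g : is_cov (fp f) (fp g) (cov_forest f g).
Proof.
rewrite (forest_processE f) linext_process_sum.
apply: (is_covariation_suml T_gt0 filtF).
  exact: adapted_continuous_forest.
move=> s; apply: is_covariation_sym;
rewrite (forest_processE g) linext_process_sum.
apply: (is_covariation_suml T_gt0 filtF).
  exact: adapted_continuous_tree.
by move=> t; apply: is_covariation_sym; exact: covariation_treeP.
Qed.

Definition exactly_pictures X f : Prop := adcont X /\ version P T X (fp f).

(* [V] accounts for the term b <Y> of K^1: it does not change covariations. *)
Definition pictures X f : Prop :=
  adcont X /\ exists V,
    [/\ adcont V, bounded_variation_paths P T V &
        version P T X (lincomb 1 1 (fp f) V)].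

Lemma exactly_pictures_pictures X f : exactly_pictures X f -> pictures X f.
Proof.
move=> [acX vX]; split=> //; exists (fun _ _ => 0).
split; [exact: adapted_continuous0|exact: bounded_variation_paths0|].
move=> u uT; apply: filterS (vX u uT) => w ->.
by rewrite /lincomb mul1r mulr0 addr0.
Qed.

Lemma exactly_pictures_leaf : exactly_pictures YP forest_leaf.
Proof.
rewrite /exactly_pictures forest_processE linextU scale1r tree_process_leaf.
split; last exact: version_refl.
by rewrite -tree_process_leaf; exact: adapted_continuous_tree.
Qed.

Lemma is_covariation_pictures X Z f g : pictures X f -> pictures Z g ->
  is_cov X Z (cov_forest f g).
Proof.
move=> [acX [V [acV bV vX]]] [acZ [W [acW bW vZ]]].
apply: (is_covariation_versionl filtF acX (version_sym vX)).
apply: (is_covariation_plus_bounded_variation T_gt0 filtF acV bV).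
apply: is_covariation_sym.
apply: (is_covariation_versionl filtF acZ (version_sym vZ)).
apply: (is_covariation_plus_bounded_variation T_gt0 filtF acW bW).
by apply: is_covariation_sym; exact: is_covariation_forest.
Qed.

(** The bounded variation parts drop out of the bracket, so factors pictured only up to such parts
    still give an exactly pictured product. *)
Lemma diamond_pictures X Z f g : pictures X f -> pictures Z g ->
  exactly_pictures (dia X Z) (f ◇ g).
Proof.
move=> pX pZ; have covXZ := is_covariation_pictures pX pZ.
have TT : 0 <= T <= T by rewrite lexx ltW.
pose M s t := condexp_process P T F (cov (tp s) (tp t) T).
have ceM u : 0 <= u <= T ->
    is_condexp P (F u) (cov_forest f g T) (process_sum (msupp f)
      (fun s => mcoeff s f) (fun s => process_sum (msupp g)
        (fun t => mcoeff t g) (M s)) u).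
  move=> uT; apply: (is_condexp_sum filtF _ _ uT) => s.
  apply: (is_condexp_sum filtF _ _ uT) => t.
  have [_ ce] := condexp_processP T_gt0 filtF mart
    (integrable_covariation_tree s t).
  exact: ce.
have iC : integrable_rv P (cov_forest f g T) by have [] := ceM T TT.
split; first exact: adapted_continuous_diamond covXZ iC.
have [_ vC _ ceN] := covariation_spec covXZ iC.
move=> u uT; have [/(_ u uT)[sFu Fu] _] := filtF.
(* At time u, the chosen conditional expectation and bracket are replaced by the bilinear
   expressions; a finite sum over pairs of trees remains. *)
apply: filterS2 (is_condexp_unique sFu Fu (ceN u uT) (ceM u uT)) (vC u uT).
move=> w; rewrite /diamond => -> ->.
have -> : fp (f ◇ g) = process_sum (msupp f) (fun s => mcoeff s f)
    (fun s => process_sum (msupp g) (fun t => mcoeff t g)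
      (fun t => dia (tp s) (tp t))).
  rewrite forest_processE diamond_linext linext_linext linext_process_sum.
  congr process_sum; apply/funext => s.
  rewrite linext_linext linext_process_sum; congr process_sum.
  by apply/funext => t; rewrite linextU scale1r tree_process_join.
rewrite /process_sum -sumrB; apply: eq_bigr => s _.
by rewrite -mulrBr -sumrB; congr (_ * _); apply: eq_bigr => t _; rewrite -mulrBr.
Qed.

Lemma exactly_pictures_lincomb (a b : R) X Z f g :
  exactly_pictures X f -> exactly_pictures Z g ->
  exactly_pictures (a *: X + b *: Z) (a *: f + b *: g).
Proof.
move=> [acX vX] [acZ vZ]; split; first exact: adapted_continuous_lincomb.
rewrite forest_processE linearD !linearZ; exact: version_lincomb.
Qed.

Lemma exactly_picturesZ (a : R) X f :
  exactly_pictures X f -> exactly_pictures (a *: X) (a *: f).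
Proof.
move=> pX; have := exactly_pictures_lincomb a 0 pX pX.
by rewrite !scale0r !addr0.
Qed.

Lemma exactly_picturesD X Z f g :
  exactly_pictures X f -> exactly_pictures Z g ->
  exactly_pictures (X + Z) (f + g).
Proof.
by move=> pX pZ; have := exactly_pictures_lincomb 1 1 pX pZ; rewrite !scale1r.
Qed.

Lemma exactly_pictures_sum (r : seq nat) (X : nat -> process)
    (f : nat -> forest R) :
  (forall i, i \in r -> exactly_pictures (X i) (f i)) ->
  exactly_pictures (\sum_(i <- r) X i) (\sum_(i <- r) f i).
Proof.
elim: r => [|i r IH] pX.
  (* The empty sum is pictured as 0 times Y. *)
  have := exactly_picturesZ 0 exactly_pictures_leaf.
  by rewrite !big_nil !scale0r.
rewrite !big_cons; apply: exactly_picturesD; first by apply: pX; rewrite mem_head.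
by apply: IH => j jr; apply: pX; rewrite in_cons jr orbT.
Qed.

Lemma processG_pictures (a b : R) k : (2 <= k)%N ->
  exactly_pictures (processG P T F YT a b k) (forestG a b k).
Proof.
have pY := exactly_pictures_leaf; have pY' := exactly_pictures_pictures pY.
elim/ltn_ind: k => k IH; rewrite leq_eqVlt => /predU1P[<-|k2].
  rewrite [processG _ _ _ _ _ _ _]Gexp2 [forestG _ _ _]Gexp2.
  by apply: exactly_picturesZ; exact: diamond_pictures.
rewrite [processG _ _ _ _ _ _ _](Gexp_rec dia a b YP k2).
rewrite [forestG _ _ _](Gexp_rec (@forest_diamond R) a b forest_leaf k2).
apply: exactly_picturesD; apply: exactly_picturesZ.
  apply: exactly_pictures_sum => j; rewrite mem_index_iota => jk.
  by apply: diamond_pictures; apply: exactly_pictures_pictures; apply: IH; lia.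
apply: diamond_pictures; first exact: pY'.
by apply: exactly_pictures_pictures; apply: IH; lia.
Qed.

(** By linearity of conditional expectation, this is the identity E_t[<Y>_T] = (Y ◇ Y)_t + <Y>_t,
    multiplied by b. *)
Lemma processK1_version (a b : R) :
  version P T (processK P T F YT a b 1)
    (fp (forestK a b 1) + b *: (QV : process)).
Proof.
have TT : 0 <= T <= T by rewrite lexx ltW.
have iY : integrable_rv P YT by have [] := intY.
have iQ : integrable_rv P (QV T).
  by have := integrable_covariation_tree leaf leaf; rewrite tree_process_leaf.
have [_ ceY] := condexp_processP T_gt0 filtF mart iY.
have [_ ceQ] := condexp_processP T_gt0 filtF mart iQ.
have iA : integrable_rv P (fun w => a * YT w + b * QV T w).
  exact: integrable_rv_lincomb.
have [_ ceA] := condexp_processP T_gt0 filtF mart iA.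
have [iK _] := filtF.
move=> u uT; have [sFu Fu] := iK u uT.
have ce := is_condexp_lincomb sFu Fu a b (ceY u uT) (ceQ u uT).
apply: filterS (is_condexp_unique sFu Fu (ceA u uT) ce) => w.
rewrite [processK _ _ _ _ _ _ _]Kexp1 => ->.
rewrite [forestK _ _ _]Kexp1 forest_processE linearD !linearZ forest_diamondUU.
rewrite /= !linextU !scale1r tree_process_join tree_process_leaf.
rewrite -[RHS]/(a * YP u w + b * (condexp_process P T F (QV T) u w - QV u w)
  + b * QV u w).
by rewrite mulrBr addrA subrK.
Qed.

Lemma processK1_pictures (a b : R) :
  pictures (processK P T F YT a b 1) (forestK a b 1).
Proof.
have TT : 0 <= T <= T by rewrite lexx ltW.
have covY := covariation_treeP leaf leaf; rewrite tree_process_leaf in covY.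
have [_ _ acQ bQ _] := covY.
have iY : integrable_rv P YT by have [] := intY.
have iQ : integrable_rv P (QV T).
  by have := integrable_covariation_tree leaf leaf; rewrite tree_process_leaf.
have iA : integrable_rv P (fun w => a * YT w + b * QV T w).
  exact: integrable_rv_lincomb.
have [cA ceA] := condexp_processP T_gt0 filtF mart iA.
split.
  rewrite [processK _ _ _ _ _ _ _]Kexp1; split=> // u uT.
  by have [] := ceA u uT.
(* The process b <Y>, written as a combination to reuse the closure lemmas. *)
exists (lincomb b 0 QV QV); split.
- exact: adapted_continuous_lincomb.
- exact: bounded_variation_paths_lincomb.
move=> u uT; apply: filterS (processK1_version a b uT) => w ->.
by rewrite /lincomb mul0r addr0 !mul1r.
Qed.

Lemma processK_pictures (a b : R) n : (2 <= n)%N ->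
  exactly_pictures (processK P T F YT a b n) (forestK a b n).
Proof.
elim/ltn_ind: n => -[|n] // IH n_gt1.
have pK k : (1 <= k < n.+1)%N ->
    pictures (processK P T F YT a b k) (forestK a b k).
  case/andP; rewrite leq_eqVlt => /predU1P[<- _|k2 kn].
    exact: processK1_pictures.
  by apply: exactly_pictures_pictures; exact: IH.
rewrite [processK _ _ _ _ _ _ _](Kexp_rec _ _ n_gt1).
rewrite [forestK _ _ _](Kexp_rec _ _ n_gt1).
apply: exactly_picturesZ; apply: exactly_pictures_sum => k.
rewrite mem_index_iota => kn.
by apply: diamond_pictures; apply: pK; lia.
Qed.

End Pictures.

(** * Assembly of the forest identities and of their pictures *)

Theorem corollary1p1 (R : realType) (d : measure_display)
    (Omega : measurableType d) (P : probability Omega R)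
    (T : R) (F : R -> set (set Omega)) (YT : Omega -> R) (a b : R) :
  0 < T ->
  filtration T F ->
  martingales_have_continuous_versions P T F ->
  measurable_wrt (F T) YT ->
  sufficiently_integrable P T F YT ->
  let Y : forest R := forest_leaf in
  let G : nat -> forest R := forestG a b in
  let K : nat -> forest R := forestK a b in
  (* the first forests of the G-expansion *)
  [/\ G 2%N = (2^-1 * a ^+ 2 + b) *: (Y ◇ Y),
      G 3%N = (a * (2^-1 * a ^+ 2 + b)) *: ((Y ◇ Y) ◇ Y),
      G 4%N = (2^-1 * (2^-1 * a ^+ 2 + b) ^+ 2) *: ((Y ◇ Y) ◇ (Y ◇ Y))
            + (a ^+ 2 * (2^-1 * a ^+ 2 + b)) *: (((Y ◇ Y) ◇ Y) ◇ Y) &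
      G 5%N = (a * (2^-1 * a ^+ 2 + b) ^+ 2) *: (((Y ◇ Y) ◇ Y) ◇ (Y ◇ Y))
            + (2^-1 * a * (2^-1 * a ^+ 2 + b) ^+ 2)
                *: (((Y ◇ Y) ◇ (Y ◇ Y)) ◇ Y)
            + (a ^+ 3 * (2^-1 * a ^+ 2 + b)) *: ((((Y ◇ Y) ◇ Y) ◇ Y) ◇ Y)]
  /\
  (* the first terms of the K-expansion; the terms not displayed (which exist
     from K^3 on) are those with more than five leaves *)
  [/\ K 1%N = a *: Y + b *: (Y ◇ Y),
      K 2%N = (2^-1 * a ^+ 2) *: (Y ◇ Y) + (a * b) *: ((Y ◇ Y) ◇ Y)
            + (2^-1 * b ^+ 2) *: ((Y ◇ Y) ◇ (Y ◇ Y)),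
      leaf_part (fun m => m <= 5)%N (K 3%N) =
        (2^-1 * a ^+ 3) *: ((Y ◇ Y) ◇ Y)
        + (2^-1 * a ^+ 2 * b) *: ((Y ◇ Y) ◇ (Y ◇ Y))
        + (a ^+ 2 * b) *: (((Y ◇ Y) ◇ Y) ◇ Y)
        + (a * b ^+ 2) *: (((Y ◇ Y) ◇ Y) ◇ (Y ◇ Y))
        + (2^-1 * a * b ^+ 2) *: (((Y ◇ Y) ◇ (Y ◇ Y)) ◇ Y),
      leaf_part (fun m => m <= 5)%N (K 4%N) =
        (2^-1 * a ^+ 4) *: (((Y ◇ Y) ◇ Y) ◇ Y)
        + (8^-1 * a ^+ 4) *: ((Y ◇ Y) ◇ (Y ◇ Y))
        + (2^-1 * a ^+ 3 * b) *: (((Y ◇ Y) ◇ Y) ◇ (Y ◇ Y))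
        + (2^-1 * a ^+ 3 * b) *: (((Y ◇ Y) ◇ (Y ◇ Y)) ◇ Y)
        + (a ^+ 3 * b) *: ((((Y ◇ Y) ◇ Y) ◇ Y) ◇ Y)
        + (2^-1 * a ^+ 3 * b) *: (((Y ◇ Y) ◇ Y) ◇ (Y ◇ Y)) &
      leaf_part (fun m => m <= 5)%N (K 5%N) =
        (2^-1 * a ^+ 5) *: ((((Y ◇ Y) ◇ Y) ◇ Y) ◇ Y)
        + (8^-1 * a ^+ 5) *: (((Y ◇ Y) ◇ (Y ◇ Y)) ◇ Y)
        + (4^-1 * a ^+ 5) *: (((Y ◇ Y) ◇ Y) ◇ (Y ◇ Y))]
  /\
  (* the K-expansion is sorted by homogeneity in (a, b), and K^n only has
     trees with n to 2n leaves; the G-expansion is sorted by leaves *)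
  [/\ forall (c : R) (n : nat), (1 <= n)%N ->
        forestK (c * a) (c * b) n = c ^+ n *: K n,
      forall (n : nat) (s : tree), (1 <= n)%N ->
        s \in msupp (K n) -> (n <= leaves s <= 2 * n)%N &
      forall (k : nat) (s : tree), (2 <= k)%N ->
        s \in msupp (G k) -> leaves s = k]
  /\
  (* reordering by leaves: collecting the trees with k leaves in all the K^n
     (only n <= k contributes) yields a Y for k = 1 and G^k for k >= 2 *)
  [/\ leaf_part (pred1 1%N) (K 1%N) = a *: Y &
      forall k : nat, (2 <= k)%N ->
        G k = \sum_(1 <= n < k.+1) leaf_part (pred1 k) (K n)]
  /\
  (* these forests picture the processes defined by the two recursions with
     the stochastic diamond product, started from Y_t and from
     E_t[a Y_T + b <Y>_T] *)
  [/\ forall k : nat, (2 <= k)%N ->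
        version P T (processG P T F YT a b k) (forest_process P T F YT (G k)),
      version P T (processK P T F YT a b 1)
        (forest_process P T F YT (K 1%N)
         + b *: (quadratic_variation P T F YT : R -> Omega -> R)) &
      forall n : nat, (2 <= n)%N ->
        version P T (processK P T F YT a b n) (forest_process P T F YT (K n))].
Proof.
move=> T_gt0 filtF mart _ intY Y G K.
have G2 := Gexp2 (@forest_diamond R) a b Y.
have G_rec := @Gexp_rec _ _ (@forest_diamond R) a b Y.
have K0 : K 0 = 0.
  (* At index 0 the step function returns half of an empty sum. *)
  by rewrite [K]/(forestK a b) /forestK /Kexp /cv_rec /= big_geq // scaler0.
have K1 := Kexp1 (@forest_diamond R) (a *: Y + b *: (Y ◇ Y)).
have K_rec := @Kexp_rec _ _ (@forest_diamond R) (a *: Y + b *: (Y ◇ Y)).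
have sep := @forest_linear_forms_separate R.
have diaC := @forest_diamondC R.
have diaDl := @forest_diamondDl R.
have diaZl := @forest_diamondZl R.
pose part5 : forest R -> forest R := leaf_part (fun m => m <= 5)%N.
pose U (s : tree) : forest R := mkmalgU s 1.
have YU : Y = U leaf by [].
have diaU s t : U s ◇ U t = U (join s t) by exact: forest_diamondUU.
have partD f g : part5 (f + g) = part5 f + part5 g by exact: leaf_partD.
have partZ c f : part5 (c *: f) = c *: part5 f by exact: leaf_partZ.
have partU s : part5 (U s) = if (leaves s <= 5)%N then U s else 0.
  exact: leaf_partU.
have part_dia f g : part5 (f ◇ g) = part5 (part5 f ◇ part5 g).
  exact: leaf_part_le_diamond.
split; last split; last split; last split.
- split.
  + exact: G2.
  + exact: (first_G3 diaC diaZl G2 G_rec).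
  + exact: (first_G4 sep diaC diaZl G2 G_rec).
  + exact: (first_G5 sep diaC diaDl diaZl G2 G_rec).
- split.
  + exact: K1.
  + exact: (first_K2 sep diaC diaDl diaZl K1 K_rec).
  + exact: (first_K3 sep diaC diaDl diaZl K1 K_rec YU diaU partD partZ partU).
  + exact: (first_K4 sep diaC diaDl diaZl K1 K_rec YU diaU partD partZ partU
      part_dia).
  + exact: (first_K5 sep diaC diaDl diaZl K1 K_rec YU diaU partD partZ partU
      part_dia).
- split.
  + move=> c n n_gt0.
    rewrite -(Kexp_homogeneous (@forest_diamondZl R) (@forest_diamondZr R)) //.
    by rewrite scalerDr !scalerA.
  + exact: (leaves_msuppK K1 K_rec).
  + exact: (leaves_msuppG G2 G_rec).
- split; first exact: (leaf_part1_K1 K1).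
  exact: (G_sum_leaf_part_K G2 G_rec K0 K1 K_rec).
split.
- move=> k k2.
  by have [] := processG_pictures T_gt0 filtF mart intY a b k2.
- exact: (processK1_version T_gt0 filtF mart intY a b).
- move=> n n2.
  by have [] := processK_pictures T_gt0 filtF mart intY a b n2.
Qed.
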